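(* Let $\mathbf A\in\mathbb R^{n\times d}$ (rank $d$) have a nondegenerate optimal design, let $\varepsilon\in(0,1)$, and set $c:=\min\{c_0,\ c_1/\kappa^{3}\}$ with $c_1:=(1/126)^2$. Run, with these valid instance constants supplied as input, the two-stage algorithm consisting of the warm-start/identification loop with tolerance $c$ followed by the restarted-FISTA facial phase (both defined in the context). The algorithm returns a $(1+\varepsilon)$-John ellipsoid, i.e. $\mathbf p\in\Delta_n$ with $\max_iv_i(\mathbf p)\le(1+\varepsilon)d$, using $$C(\mathbf A)+O\Big(\sqrt\kappa\,\log\frac{\Theta_{\mathrm A}}{\varepsilon}\Big)\ \text{ leverage-score queries},\qquad \Theta_{\mathrm A}:=\frac{\sqrt{L_{\mathrm{loc}}\,\kappa_{\mathrm{loc}}\,c_0}}{d}+2,$$ where $C(\mathbf A)=\max\{K_{\mathrm{id}},K_{\mathrm{gap}}(c/d)\}$ is independent of $\varepsilon$ and the $O(\cdot)$ hides an absolute constant. All queries made in the facial phase are at weight vectors $\mathbf w$ supported on $S^\star$ with $\mathbf M(\mathbf w)\succ0$ (possibly with some negative entries), and the returned point is a design in $\operatorname{relint}\Delta_{S^\star}$.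
   Context: Setting. $\mathbf A\in\mathbb R^{n\times d}$ has rows $\mathbf a_1,\dots,\mathbf a_n$ and rank $d$. For $\mathbf p\in\mathbb R^n$, $\mathbf M(\mathbf p)=\sum_ip_i\mathbf a_i\mathbf a_i^\top$; when $\mathbf M(\mathbf p)\succ0$, $v_i(\mathbf p)=\mathbf a_i^\top\mathbf M(\mathbf p)^{-1}\mathbf a_i$ and $f(\mathbf p)=-\log\det\mathbf M(\mathbf p)$. $\Delta_n=\{\mathbf p\ge0:\sum p_i=1\}$ (its elements are designs), $\Delta_S=\{\mathbf p\in\Delta_n:\operatorname{supp}\mathbf p\subseteq S\}$. $g(\mathbf p)=\max_iv_i(\mathbf p)-d$. A leverage-score query at $\mathbf w$ with $\mathbf M(\mathbf w)\succ0$ returns $(v_i(\mathbf w))_{i\in[n]}$. Nondegeneracy. An optimal design $\mathbf p^\star$ minimizes $f$ over $\Delta_n$, $f^\star=f(\mathbf p^\star)$, $S^\star=\{i:v_i(\mathbf p^\star)=d\}$, $m=|S^\star|$. It is nondegenerate if (i) $\operatorname{supp}\mathbf p^\star=S^\star$ and $\gamma_{\mathrm{sc}}:=\min_{i\notin S^\star}(d-v_i(\mathbf p^\star))>0$ (minimum over the empty set is $+\infty$); (ii) $\{\mathbf a_i\mathbf a_i^\top\}_{i\in S^\star}$ are linearly independent. $p^\star_{\min}=\min_{i\in S^\star}p^\star_i$. Facial quantities. $V=\{\mathbf p\in\mathbb R^n:\operatorname{supp}\mathbf p\subseteq S^\star,\sum_ip_i=1\}$, $T^\star=\{\boldsymbol\delta:\operatorname{supp}\boldsymbol\delta\subseteq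 S^\star,\sum_i\delta_i=0\}$, $h$ is the restriction of $f$ to $\{\mathbf p\in V:\mathbf M(\mathbf p)\succ0\}$, $\widehat{\mathbf H}(\mathbf p)=\big((\mathbf a_i^\top\mathbf M(\mathbf p)^{-1}\mathbf a_j)^2\big)_{i,j\in S^\star}$. $\mu_\star=\lambda_{\min}(\widehat{\mathbf H}(\mathbf p^\star)|_{T^\star})$ (presupposing $T^\star\ne\{0\}$), $\widehat L_\star=\lambda_{\max}(\widehat{\mathbf H}(\mathbf p^\star))$, $\kappa=\widehat L_\star/\mu_\star$, $L_{\mathrm{loc}}=4\widehat L_\star$, $\mu_{\mathrm{loc}}=\tfrac49\mu_\star$, $\kappa_{\mathrm{loc}}=L_{\mathrm{loc}}/\mu_{\mathrm{loc}}=9\kappa$. $\zeta(t)=t-\log(1+t)$, $\bar r=\min\{\tfrac12,\ \gamma_{\mathrm{sc}}/(2d),\ p^\star_{\min}\sqrt{\mu_\star}/2\}$, $c_0=\zeta(\bar r)$. Warm-start/identification loop (tolerance $c$). Start from the Kumar--Yıldırım volumetric initialization: greedily construct $d$ (near-)orthogonal directions, for each take the two rows of $\mathbf A$ extremal in that direction, and let $\mathbf p$ be the uniform design on these at most $2d$ rows (it satisfies $f(\mathbf p)-f^\star=O(d\log d)$). While $\max_iv_i(\mathbf p)-d>c$ or $\min_{i:p_i>0}v_i(\mathbf p)<d-\gamma_{\mathrm{sc}}/2$: query $\mathbf v=\mathbf v(\mathbf p)$, let $j_+\in\arg\max_iv_i$, $j_-\in\arg\min_{i:p_i>0}v_i$;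 if $v_{j_+}-d\ge d-v_{j_-}$ put $\gamma=\frac{v_{j_+}-d}{d(v_{j_+}-1)}$, $\mathbf p\leftarrow(1-\gamma)\mathbf p+\gamma\mathbf e_{j_+}$; otherwise put $\gamma_{\max}=\frac{p_{j_-}}{1-p_{j_-}}$, $\gamma=\min\{\frac{d-v_{j_-}}{d(v_{j_-}-1)},\gamma_{\max}\}$ if $v_{j_-}>1$ and $\gamma=\gamma_{\max}$ if $v_{j_-}\le1$, and $\mathbf p\leftarrow(1+\gamma)\mathbf p-\gamma\mathbf e_{j_-}$. (These are away-step Frank--Wolfe steps with exact line search; one query per iteration.) Constants of the loop. Let $(\mathbf p^{(k)})$ be the sequence generated by this update without the stopping test. $K_{\mathrm{id}}$ is an index such that $\operatorname{supp}\mathbf p^{(k)}\subseteq S^\star$ for all $k\ge K_{\mathrm{id}}$; $K_{\mathrm{gap}}(\varepsilon')$ is an index such that $g(\mathbf p^{(k)})\le\varepsilon'd$ for all $k\ge K_{\mathrm{gap}}(\varepsilon')$. Both are finite by known results on away-step Frank--Wolfe (Zhao; Bomze--Rinaldi--Zeffiro). Restarted-FISTA facial phase. Let $\mathbf x_0$ be the exit point of the loop and $Q=\Delta_{S^\star}$. One cycle of length $N=\lceil\sqrt{8\kappa_{\mathrm{loc}}}\rceil-1$: $\mathbf y_1=\mathbf x_0$, $t_1=1$, and for $k=1,\dots,N$, $\mathbf x_k=P_Q(\mathbf y_k-\tfrac1{L_{\mathrm{loc}}}\nabla h(\mathbf y_k))$, $t_{k+1}=\tfrac12(1+\sqrt{1+4t_k^2})$,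 $\mathbf y_{k+1}=\mathbf x_k+\frac{t_k-1}{t_{k+1}}(\mathbf x_k-\mathbf x_{k-1})$, where $P_Q$ is Euclidean projection onto $Q$ and $\nabla h(\mathbf y)$ is the orthogonal projection onto $T^\star$ of the vector $-(v_i(\mathbf y))_{i\in S^\star}$ (one query at $\mathbf y$). At each cycle end one extra query tests $g(\mathbf x_N)\le\varepsilon d$; if it holds return $\mathbf x_N$, otherwise start a new cycle from $\mathbf x_0:=\mathbf x_N$. *)

(* Defs.v *)
From HB Require Import structures.
From mathcomp Require Import all_boot all_order all_algebra.
From mathcomp Require Import all_classical all_reals all_analysis.
Set Implicit Arguments.
Unset Strict Implicit.
Unset Printing Implicit Defensive.
Import Order.TTheory GRing.Theory Num.Theory.
Local Open Scope classical_set_scope.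
Local Open Scope ring_scope.

(* The rows of A are the vectors a_i; weight vectors are row vectors. *)

Section Euclidean.
Variables (R : realType) (n : nat).
Implicit Types (x y : 'rV[R]_n) (C : set 'rV[R]_n).

Definition dotv x y : R := (x *m y^T) 0 0.

Definition enorm x : R := Num.sqrt (dotv x x).

Definition supp x : {set 'I_n} := [set i | x 0 i != 0]%SET.

Definition is_proj C y x : Prop :=
  C x /\ forall z, C z -> enorm (y - x) <= enorm (y - z).

(* Euclidean projection, by choice; the default 0 is only taken when C has no
   nearest point to y, which does not happen for the closed convex nonempty
   sets used below. *)
Definition eproj C y : 'rV[R]_n := xget 0 [set x | is_proj C y x].

Definition aff C : set 'rV[R]_n :=
  [set y | exists (k : nat) (x : 'I_k -> 'rV[R]_n) (l : 'I_k -> R),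
     [/\ forall i, C (x i), \sum_(i < k) l i = 1 &
         y = \sum_(i < k) l i *: x i]].

Definition relint C : set 'rV[R]_n :=
  [set x | C x /\ exists2 e : R, 0 < e &
     forall y, aff C y -> enorm (y - x) < e -> C y].

Definition posdef (B : 'M[R]_n) : Prop :=
  B^T = B /\ forall x, x != 0 -> 0 < (x *m B *m x^T) 0 0.

Definition simplex : set 'rV[R]_n :=
  [set p | (forall i, 0 <= p 0 i) /\ \sum_i p 0 i = 1].

Definition face (S : {set 'I_n}) : set 'rV[R]_n :=
  [set p | simplex p /\ supp p \subset S].

Definition zero_sum (S : {set 'I_n}) : set 'rV[R]_n :=
  [set x | supp x \subset S /\ \sum_i x 0 i = 0].

(* Coordinates, in R^S, of a vector supported on S. *)
Definition restr (S : {set 'I_n}) x : 'rV[R]_#|S| :=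
  colsub (enum_val (A := mem S)) x.

Definition lambda_max (B : 'M[R]_n) : R := sup [set l : R | eigenvalue B l].

End Euclidean.

(* Smallest eigenvalue of the compression of H (acting on R^S) to a subspace T
   of vectors supported on S: x in T is an eigenvector for l when H x - l x is
   orthogonal to T. *)
Definition lambda_min_on (R : realType) (n : nat) (S : {set 'I_n})
    (H : 'M[R]_#|S|) (T : set 'rV[R]_n) : R :=
  inf [set l : R | exists x, [/\ T x, x != 0 &
    forall y, T y -> dotv (restr S x *m H) (restr S y) = l * dotv x y]].

Section Design.
Variables (R : realType) (n d : nat) (A : 'M[R]_(n, d)).
Implicit Types (p ps : 'rV[R]_n) (S : {set 'I_n}).

Definition infoM p : 'M[R]_d :=
  \sum_i p 0 i *: ((row i A)^T *m row i A).

(* lev, fdes, maxgap and Hhat are meaningful when infoM p is positive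
   definite. *)
Definition lev p (i : 'I_n) : R :=
  (row i A *m invmx (infoM p) *m (row i A)^T) 0 0.

Definition fdes p : R := - ln (\det (infoM p)).

Definition maxlev p : \bar R := (\big[maxe/-oo]_i (lev p i)%:E)%E.

Definition maxgap p : \bar R := (maxlev p - d%:R%:E)%E.

Definition minlev_supp p : \bar R :=
  (\big[mine/+oo]_(i | (0 < p 0 i)%R) (lev p i)%:E)%E.

Definition optimal_design ps : Prop :=
  [/\ simplex ps, posdef (infoM ps) &
      forall q, simplex q -> posdef (infoM q) -> fdes ps <= fdes q].

Definition Sstar ps : {set 'I_n} := [set i | lev ps i == d%:R]%SET.

Definition gamma_sc ps : \bar R :=
  (\big[mine/+oo]_(i | i \notin Sstar ps) (d%:R - lev ps i)%:E)%E.

Definition nondegenerate_design ps : Prop :=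
  [/\ supp ps = Sstar ps, (0 < gamma_sc ps)%E &
      free [seq (row i A)^T *m row i A | i <- enum (Sstar ps)]].

Definition pmin ps : \bar R :=
  (\big[mine/+oo]_(i in Sstar ps) (ps 0%R i)%:E)%E.

Definition Hhat S p : 'M[R]_#|S| :=
  \matrix_(i, j) ((row (enum_val i) A *m invmx (infoM p)
                     *m (row (enum_val j) A)^T) 0 0) ^+ 2.

Definition mu_star ps : R :=
  lambda_min_on (Hhat (Sstar ps) ps) (zero_sum (Sstar ps)).

Definition L_star ps : R := lambda_max (Hhat (Sstar ps) ps).

Definition kappa ps : R := L_star ps / mu_star ps.
Definition L_loc ps : R := 4 * L_star ps.
Definition mu_loc ps : R := 4 / 9 * mu_star ps.
Definition kappa_loc ps : R := L_loc ps / mu_loc ps.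

Definition zeta (t : R) : R := t - ln (1 + t).

(* A minimum of extended reals since gamma_sc may be +oo; it is at most 1/2. *)
Definition rbar ps : R :=
  fine (mine (2^-1)%:E
         (mine (gamma_sc ps * ((2 * d%:R)^-1)%:E)
               (pmin ps * (Num.sqrt (mu_star ps) / 2)%:E)))%E.

Definition c_0 ps : R := zeta (rbar ps).
Definition c_1 : R := (1 / 126) ^+ 2.
Definition tol ps : R := Num.min (c_0 ps) (c_1 / kappa ps ^+ 3).

Definition Theta_A ps : R :=
  Num.sqrt (L_loc ps * kappa_loc ps * c_0 ps) / d%:R + 2.

Definition uniform_on (B : {set 'I_n}) : 'rV[R]_n :=
  \row_i (if i \in B then #|B|%:R^-1 else 0).

(* Kumar-Yildirim volumetric initialization: a k and b k index the rows extremal in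
   direction dir k, and each new direction is orthogonal to the vectors
   u j found so far, u k being a vector spanned by the two rows selected at
   stage k and not orthogonal to dir k. The original procedure takes for u k
   the chord between the two rows; for the symmetrized point set {a_i, -a_i}
   one takes the row with the larger absolute value. Both choices, and the
   choice of the directions, are left open. *)
Definition ky_init p : Prop :=
  exists (dir u : 'I_d -> 'rV[R]_d) (a b : 'I_d -> 'I_n),
    [/\ forall k i, dotv (dir k) (row i A) <= dotv (dir k) (row (a k) A),
        forall k i, dotv (dir k) (row (b k) A) <= dotv (dir k) (row i A),
        forall k, (u k <= col_mx (row (a k) A) (row (b k) A))%MS
                  /\ dotv (dir k) (u k) != 0,
        forall j k : 'I_d, (j < k)%N -> dotv (dir k) (u j) = 0 &
        p = uniform_on ([set a k | k : 'I_d] :|: [set b k | k : 'I_d])%SET].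

Definition ls_step (v : R) : R := (v - d%:R) / (d%:R * (v - 1)).

Definition away_step (w v : R) : R :=
  let gmax := w / (1 - w) in
  if 1 < v then Num.min ((d%:R - v) / (d%:R * (v - 1))) gmax else gmax.

Definition afw_update p (jp jm : 'I_n) : 'rV[R]_n :=
  let vp := lev p jp in let vm := lev p jm in
  if d%:R - vm <= vp - d%:R then
    let g := ls_step vp in (1 - g) *: p + g *: delta_mx 0 jp
  else
    let g := away_step (p 0 jm) vm in (1 + g) *: p - g *: delta_mx 0 jm.

(* Relational, since ties in the argmax and argmin may be broken arbitrarily. *)
Definition afw_step p p' : Prop :=
  exists jp jm : 'I_n,
    [/\ forall i, lev p i <= lev p jp,
        0 < p 0 jm,
        forall i, 0 < p 0 i -> lev p jm <= lev p i &
        p' = afw_update p jp jm].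

Definition afw_sequence (P : nat -> 'rV[R]_n) : Prop :=
  ky_init (P 0) /\ forall k, afw_step (P k) (P k.+1).

Definition loop_test (gam : \bar R) (c : R) p : bool :=
  ((c%:E < maxgap p)
   || (minlev_supp p < d%:R%:E - gam * (2^-1)%:E))%E.

Definition loop_exit gam c (P : nat -> 'rV[R]_n) (k : nat) : Prop :=
  ~~ loop_test gam c (P k) /\ forall j, (j < k)%N -> loop_test gam c (P j).

(* One query per evaluated test, including the last one; the loop body reuses
   the scores of the test. *)
Definition loop_queries (P : nat -> 'rV[R]_n) (k : nat) : seq 'rV[R]_n :=
  [seq P j | j <- iota 0 k.+1].

Definition is_K_id S (P : nat -> 'rV[R]_n) (K : nat) : Prop :=
  forall k, (K <= k)%N -> supp (P k) \subset S.

Definition is_K_gap (e : R) (P : nat -> 'rV[R]_n) (K : nat) : Prop :=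
  forall k, (K <= k)%N -> (maxgap (P k) <= (e * d%:R)%:E)%E.

Section Facial.
Variables (S : {set 'I_n}) (L kl : R).

Definition grad_h y : 'rV[R]_n :=
  eproj (zero_sum S) (\row_i (if i \in S then - lev y i else 0)).

Definition fista_next (t : R) : R := (1 + Num.sqrt (1 + 4 * t ^+ 2)) / 2.

(* State after k iterations: (x_k, y_(k+1), t_(k+1)). *)
Fixpoint fista (x0 : 'rV[R]_n) (k : nat) : 'rV[R]_n * 'rV[R]_n * R :=
  if k is k'.+1 then
    let: (x, y, t) := fista x0 k' in
    let x' := eproj (face S) (y - L^-1 *: grad_h y) in
    let t' := fista_next t in
    (x', x' + ((t - 1) / t') *: (x' - x), t')
  else (x0, x0, 1).

Definition cycle_len : nat := `|Num.ceil (Num.sqrt (8 * kl))|%N.-1.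

Definition fista_cycle x0 : 'rV[R]_n := (fista x0 cycle_len).1.1.

(* y_1, ..., y_N, then the test at x_N. *)
Definition cycle_queries x0 : seq 'rV[R]_n :=
  rcons [seq (fista x0 k).1.2 | k <- iota 0 cycle_len] (fista_cycle x0).

Definition facial_point x0 (r : nat) : 'rV[R]_n := iter r fista_cycle x0.

(* The phase started at x0 returns after exactly r cycles. *)
Definition facial_return (eps : R) x0 (r : nat) : Prop :=
  let passed j := (maxgap (facial_point x0 j) <= (eps * d%:R)%:E)%E in
  [/\ (0 < r)%N, passed r & forall j, (0 < j < r)%N -> ~~ passed j].

Definition facial_queries x0 (r : nat) : seq 'rV[R]_n :=
  flatten [seq cycle_queries (facial_point x0 j) | j <- iota 0 r].

End Facial.

End Design.

(* Main.v *)
Require Import Defs.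
From HB Require Import structures.
From mathcomp Require Import all_boot all_order all_algebra.
From mathcomp Require Import complex.
From mathcomp Require Import all_classical all_reals all_analysis.
From mathcomp Require Import ring lra.
Set Implicit Arguments.
Unset Strict Implicit.
Unset Printing Implicit Defensive.
Import Order.TTheory GRing.Theory Num.Theory numFieldNormedType.Exports.
Local Open Scope classical_set_scope.
Local Open Scope ring_scope.

(* Let l_1..l_d be the eigenvalues of M(q) relative to M(p). Then the Bregman
   divergence of f = -log det M between p and q is the sum of zeta(l_k - 1), while
   the quadratic form of (a_i^T M(p)^-1 a_j)^2 at q - p is the sum of (l_k - 1)^2,
   so every local estimate on f reduces to a scalar estimate on zeta.

   Warm-start loop: an exact line-search step decreases f by a definite amount as
   long as the gap is bounded below, and a drop step removes a support point, so
   f + const * |supp| is a Lyapunov function and f(p_k) tends to f*. Once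
   f(p_k) - f* is small, every index outside S* is an away index whose step
   is clipped, hence dropped, and none is ever added.

   Facial phase: f - f* <= tol forces |x_0 - p*| to be so small that the ball of that
   radius around p* lies in the region where f is convex and L_loc-smooth on the
   face. With u_k = x_k + t (y_(k+1) - x_k), the FISTA Lyapunov inequality bounds
   |u_k - p*| by |x_0 - p*|, and x_k and y_(k+1) are convex combinations of points
   of that ball, so the iterates never leave it. Quadratic growth at p* then halves
   f - f* over each cycle. *)

(** * Euclidean space and the real spectral theorem *)

(** [mu_star] and [L_star] describe the Hessian at the single point [ps], while FISTA queries points
    that may have negative entries, so neither feasibility nor a global smoothness constant is
    available. All estimates are therefore made in the local norm at [ps] and carried to a nearby y
    at the cost of a factor 2. The factor 4 in [L_loc] pays for this: the divergence from y to x is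
    then at most (L_loc / 2) |x - y|^2. Curvature from below enters only as the growth bound (2/9)
    mu |x - ps|^2, and with (N + 1)^2 >= 8 kappa_loc = 72 kappa these constants leave the factor 1/2
    per cycle. The finiteness of K_id and K_gap is proved here, from f(p_k) -> f* alone: f - f* is
    the Bregman divergence from [ps] plus the slack sum_i p_i (d - v_i), with v_i taken at [ps]. The
    divergence controls every leverage score, and the slack controls the weight outside S. *)

Section EuclideanTheory.
Variables (R : realType) (n : nat).
Implicit Types x y z : 'rV[R]_n.

Lemma dotvE x y : dotv x y = \sum_i x 0 i * y 0 i.
Proof. by rewrite /dotv mxE; apply: eq_bigr => i _; rewrite mxE. Qed.

Lemma dotvC x y : dotv x y = dotv y x.
Proof. by rewrite !dotvE; apply: eq_bigr => i _; rewrite mulrC. Qed.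

Lemma dotvDl x y z : dotv (x + y) z = dotv x z + dotv y z.
Proof. by rewrite /dotv mulmxDl mxE. Qed.

Lemma dotvZl a x z : dotv (a *: x) z = a * dotv x z.
Proof. by rewrite /dotv -scalemxAl mxE. Qed.

Lemma dotvNl x z : dotv (- x) z = - dotv x z.
Proof. by rewrite /dotv mulNmx mxE. Qed.

Lemma dotvBl x y z : dotv (x - y) z = dotv x z - dotv y z.
Proof. by rewrite dotvDl dotvNl. Qed.

Lemma dotvDr x y z : dotv z (x + y) = dotv z x + dotv z y.
Proof. by rewrite dotvC dotvDl !(dotvC z). Qed.

Lemma dotvZr a x z : dotv z (a *: x) = a * dotv z x.
Proof. by rewrite dotvC dotvZl dotvC. Qed.

Lemma dotvNr x z : dotv z (- x) = - dotv z x.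
Proof. by rewrite dotvC dotvNl dotvC. Qed.

Lemma dotvBr x y z : dotv z (x - y) = dotv z x - dotv z y.
Proof. by rewrite dotvDr dotvNr. Qed.

Lemma dotv_ge0 x : 0 <= dotv x x.
Proof. by rewrite dotvE; apply: sumr_ge0 => i _; rewrite -expr2 sqr_ge0. Qed.

Lemma dotv_eq0 x : dotv x x = 0 -> x = 0.
Proof.
rewrite dotvE => /eqP; rewrite psumr_eq0; last first.
  by move=> i _; rewrite -expr2 sqr_ge0.
move=> /allP h; apply/rowP => i; rewrite mxE.
by have := h i (mem_index_enum _); rewrite /= mulf_eq0 orbb => /eqP.
Qed.

Lemma dotv_gt0 x : x != 0 -> 0 < dotv x x.
Proof.
by move=> x0; rewrite lt_neqAle dotv_ge0 andbT eq_sym; apply: contra_neq x0; apply: dotv_eq0.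
Qed.

Lemma dotv_delta x i : dotv x (delta_mx 0 i) = x 0 i.
Proof.
rewrite dotvE (bigD1 i) //= mxE !eqxx mulr1 big1 ?addr0 // => j ji.
by rewrite mxE (negbTE ji) andbF mulr0.
Qed.

Lemma dotv_mulmx (B : 'M[R]_n) x y : dotv (x *m B) y = dotv x (y *m B^T).
Proof. by rewrite /dotv trmx_mul trmxK mulmxA. Qed.

Lemma enorm_sqr x : enorm x ^+ 2 = dotv x x.
Proof. by rewrite sqr_sqrtr // dotv_ge0. Qed.

Lemma ler_enorm x y : (enorm x <= enorm y) = (dotv x x <= dotv y y).
Proof. by rewrite ler_sqrt // dotv_ge0. Qed.

Lemma cauchy_schwarz x y : dotv x y ^+ 2 <= dotv x x * dotv y y.
Proof.
have [->|y0] := eqVneq y 0.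
  have z0 : dotv (0 : 'rV[R]_n) 0 = 0 by rewrite dotvE big1 // => i _; rewrite mxE mul0r.
  have -> : dotv x 0 = 0 by rewrite dotvE big1 // => i _; rewrite mxE mulr0.
  by rewrite z0 mulr0 expr0n.
have yy := dotv_gt0 y0.
have := dotv_ge0 (dotv y y *: x - dotv x y *: y).
rewrite !(dotvBl, dotvBr, dotvZl, dotvZr) (dotvC y x) => h.
have : 0 <= dotv y y * (dotv x x * dotv y y - dotv x y ^+ 2) by lra.
by rewrite pmulr_rge0 // subr_ge0.
Qed.

End EuclideanTheory.

Lemma sum_cauchy_schwarz (R : realType) (I : finType) (f g : I -> R) :
  (\sum_i f i * g i) ^+ 2 <= (\sum_i f i ^+ 2) * (\sum_i g i ^+ 2).
Proof.
have sumE (F : I -> R) : \sum_i F i = \sum_(i < #|I|) F (enum_val i).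
  by rewrite (reindex _ (onW_bij _ (enum_val_bij I))).
have := cauchy_schwarz (\row_(i < #|I|) f (enum_val i)) (\row_i g (enum_val i)).
rewrite !dotvE !sumE.
by congr (_ ^+ 2 <= _ * _); apply: eq_bigr => i _; rewrite !mxE ?expr2.
Qed.

Section Spectral.
Variable R : realType.

(** Over R[i] there is an eigenvector w = x + iy with eigenvalue a. Comparing (x B).y with x.(y B)
    gives Im a (|x|^2 + |y|^2) = 0, so a is real, and whichever of x and y is nonzero is a real
    eigenvector. *)
Lemma sym_eigenvector n (B : 'M[R]_n) : B^T = B -> (0 < n)%N ->
  exists (l : R) (v : 'rV_n), v != 0 /\ v *m B = l *: v.
Proof.
move=> symB n0.
have [a] := eigenvalue_closed (map_mx (real_complex R) B) n0.
move=> /eigenvalueP [w wB w0].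
pose x := map_mx (@complex.Re R) w; pose y := map_mx (@complex.Im R) w.
have ReD (I : finType) (F : I -> R[i]) : complex.Re (\sum_i F i) = \sum_i complex.Re (F i).
  by elim/big_rec2 : _ => // i u v _ <-; case: (F i) => ? ?; case: v.
have ImD (I : finType) (F : I -> R[i]) : complex.Im (\sum_i F i) = \sum_i complex.Im (F i).
  by elim/big_rec2 : _ => // i u v _ <-; case: (F i) => ? ?; case: v.
have xB : x *m B = complex.Re a *: x - complex.Im a *: y.
  apply/rowP => j; have /rowP/(_ j)/(congr1 (@complex.Re R)) := wB; rewrite !mxE ReD.
  move=> e; transitivity (complex.Re (a * w 0 j)); last by case: (a) (w 0 j) => ? ? [].
  rewrite -e; apply: eq_bigr => k _; rewrite !mxE.
  by case: (w 0 k) => ? ? /=; rewrite mulr0 subr0.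
have yB : y *m B = complex.Im a *: x + complex.Re a *: y.
  apply/rowP => j; have /rowP/(_ j)/(congr1 (@complex.Im R)) := wB; rewrite !mxE ImD.
  move=> e; transitivity (complex.Im (a * w 0 j)); last first.
    by case: (a) (w 0 j) => ? ? [? ?] /=; rewrite addrC.
  rewrite -e; apply: eq_bigr => k _; rewrite !mxE.
  by case: (w 0 k) => ? ? /=; rewrite mulr0 add0r.
have im0 : complex.Im a = 0.
  have := dotv_mulmx B x y; rewrite symB xB yB dotvBl !dotvZl dotvDr !dotvZr => e.
  have : complex.Im a * (dotv x x + dotv y y) = 0 by lra.
  move/eqP; rewrite mulf_eq0 => /orP[/eqP //|/eqP xy0].
  have := dotv_ge0 x; have := dotv_ge0 y => y_ge0 x_ge0.
  have x0 : x = 0 by apply: dotv_eq0; lra.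
  have y0 : y = 0 by apply: dotv_eq0; lra.
  case/eqP: w0; apply/rowP => j; move/rowP: x0 => /(_ j); move/rowP: y0 => /(_ j).
  by rewrite !mxE; case: (w 0 j) => u v /= -> ->.
rewrite im0 !scale0r subr0 add0r in xB yB.
have [x0|x0] := eqVneq x 0; last by exists (complex.Re a), x.
exists (complex.Re a), y; split=> //; apply: contra_neq w0 => y0.
apply/rowP => j; move/rowP: x0 => /(_ j); move/rowP: y0 => /(_ j).
by rewrite !mxE; case: (w 0 j) => u v /= -> ->.
Qed.

(* The Householder reflection exchanging e_0 and u. *)
Lemma orthogonal_first_row n (u : 'rV[R]_(1 + n)) : dotv u u = 1 ->
  exists U : 'M[R]_(1 + n), U *m U^T = 1%:M /\ delta_mx 0 0 *m U = u.
Proof.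
move=> u1; pose e : 'rV[R]_(1 + n) := delta_mx 0 0.
have e1 : dotv e e = 1 by rewrite dotv_delta mxE.
have [eu|ne] := eqVneq e u.
  by exists 1%:M; rewrite trmx1 !mulmx1.
have [w wE] : exists w, w = e - u by exists (e - u).
have w0 : dotv w w != 0 by rewrite gt_eqF // dotv_gt0 // wE subr_eq0.
have ww : dotv w w = 2 * dotv e w.
  by rewrite wE !(dotvBl, dotvBr) e1 u1 (dotvC u e); ring.
pose c := 2 / dotv w w.
have wwT : w *m w^T = (dotv w w)%:M by rewrite [LHS]mx11_scalar.
exists (1%:M - c *: (w^T *m w)).
have tU : (1%:M - c *: (w^T *m w))^T = 1%:M - c *: (w^T *m w).
  by rewrite linearB /= linearZ /= trmx1 trmx_mul trmxK.
split.
  rewrite tU mulmxBl mul1mx mulmxBr mulmx1 -scalemxAl -scalemxAr.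
  rewrite (mulmxA (w^T *m w)) -(mulmxA w^T w) wwT mul_mx_scalar -scalemxAl !scalerA.
  move: (w^T *m w) => X; apply/matrixP => i j; rewrite !mxE /c.
  by field.
rewrite mulmxBr mulmx1 -scalemxAr mulmxA.
have -> : delta_mx 0 0 *m w^T = (dotv e w)%:M by rewrite [LHS]mx11_scalar.
rewrite mul_scalar_mx scalerA.
have -> : c * dotv e w = 1 by rewrite /c ww; field; move: w0; rewrite ww mulf_eq0 negb_or => /andP[].
by rewrite scale1r wE opprB addrC subrK.
Qed.

(** Deflation: with a unit eigenvector as first row of U, the conjugate of B has first row l e_0,
    symmetry clears its first column, and induction handles the remaining block. *)
Lemma sym_spectral n (B : 'M[R]_n) : B^T = B ->
  exists (U : 'M[R]_n) (l : 'rV[R]_n),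
    U *m U^T = 1%:M /\ U *m B *m U^T = diag_mx l.
Proof.
elim: n B => [|n IH] B.
  by move=> _; exists 1%:M, 0; split; apply/matrixP => -[].
change n.+1 with (1 + n)%N in B |- *.
move=> symB; have [l [v [v0 vB]]] := sym_eigenvector symB isT.
pose u := (enorm v)^-1 *: v.
have nv : enorm v != 0.
  by rewrite gt_eqF // sqrtr_gt0 dotv_gt0.
have u1 : dotv u u = 1.
  by rewrite dotvZl dotvZr -enorm_sqr; field.
have uB : u *m B = l *: u by rewrite -scalemxAl vB !scalerA mulrC.
have [U [UU eU]] := orthogonal_first_row u1.
have [C defC] : exists C, C = U *m B *m U^T by exists (U *m B *m U^T).
have symC : C^T = C by rewrite defC !trmx_mul trmxK symB !mulmxA.
have row0 : forall j, C 0 j = l * (j == 0)%:R.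
  move=> j; have -> : C 0 j = ((delta_mx 0 0 : 'rV_(1 + n)) *m C) 0 j by rewrite -rowE [RHS]mxE.
  rewrite defC !mulmxA eU uB -scalemxAl -eU -mulmxA UU mulmx1 !mxE /=.
  by rewrite eq_sym.
pose C' := drsubmx C.
have symC' : C'^T = C' by rewrite /C' trmx_drsub symC.
have CE : C = block_mx l%:M 0 0 C'.
  rewrite -[LHS]submxK; congr block_mx.
  - apply/matrixP => i j; rewrite !mxE !ord1 /=.
    have -> : lshift n 0 = 0 :> 'I_(1 + n) by apply/val_inj.
    by rewrite row0 eqxx mulr1.
  - apply/matrixP => i j; rewrite !mxE !ord1.
    have -> : lshift n 0 = 0 :> 'I_(1 + n) by apply/val_inj.
    by rewrite row0 (_ : (_ == 0) = false) ?mulr0 //; apply/negbTE/eqP => /(congr1 val).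
  - apply/matrixP => i j; rewrite !mxE !ord1 -symC mxE.
    have -> : lshift n 0 = 0 :> 'I_(1 + n) by apply/val_inj.
    by rewrite row0 (_ : (_ == 0) = false) ?mulr0 //; apply/negbTE/eqP => /(congr1 val).
have [V [m [VV VC]]] := IH _ symC'.
exists (block_mx 1%:M 0 0 V *m U), (row_mx (\row__ l) m); split.
  rewrite trmx_mul mulmxA -(mulmxA _ U) UU mulmx1 tr_block_mx !trmx0 trmx1.
  by rewrite mulmx_block !(mul0mx, mulmx0, mul1mx, addr0, add0r) VV -scalar_mx_block.
rewrite trmx_mul !mulmxA -(mulmxA _ U) -(mulmxA _ (U *m B)) -defC CE.
rewrite tr_block_mx !trmx0 trmx1.
rewrite !mulmx_block !(mul0mx, mulmx0, mul1mx, mulmx1, addr0, add0r) VC diag_mx_row.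
by congr block_mx; apply/matrixP => i j; rewrite !mxE !ord1 eqxx.
Qed.

Lemma diag_mx_quad n (l z : 'rV[R]_n) :
  (z *m diag_mx l *m z^T) 0 0 = \sum_k l 0 k * z 0 k ^+ 2.
Proof. by rewrite mxE; apply: eq_bigr => k _; rewrite mul_mx_diag !mxE; ring. Qed.

(** Whiten B by the inverse square roots of its eigenvalues, then diagonalize the transformed C by
    an orthogonal V, which preserves the identity. *)
Lemma pencil_spectral n (B C : 'M[R]_n) : posdef B -> C^T = C ->
  exists (W : 'M[R]_n) (l : 'rV[R]_n),
    W *m B *m W^T = 1%:M /\ W *m C *m W^T = diag_mx l.
Proof.
move=> [symB posB] symC; have [U [m [UU UB]]] := sym_spectral symB.
have m0 k : 0 < m 0 k.
  pose z : 'rV_n := delta_mx 0 k *m U.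
  have z0 : z != 0.
    apply: contra_eq_neq (_ : dotv z z = 1) => [->|].
      by rewrite dotvE big1 ?(eq_sym 0) ?oner_eq0 // => i _; rewrite mxE mul0r.
    rewrite dotv_mulmx /z -mulmxA UU mulmx1.
    by rewrite dotv_delta mxE !eqxx.
  have := posB z z0; rewrite /z trmx_mul !mulmxA -(mulmxA _ U) -(mulmxA _ (U *m B)) UB.
  rewrite diag_mx_quad (bigD1 k) //= mxE !eqxx expr1n mulr1 big1 ?addr0 // => j jk.
  by rewrite mxE (negbTE jk) andbF expr0n mulr0.
pose D := diag_mx (\row_k (Num.sqrt (m 0 k))^-1).
have DBD : D *m U *m B *m (D *m U)^T = 1%:M.
  rewrite trmx_mul tr_diag_mx !mulmxA -(mulmxA _ U) -(mulmxA _ (U *m B)) UB.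
  apply/matrixP => i j; rewrite mul_mx_diag mul_diag_mx !mxE.
  case: eqP => [->|_]; last by rewrite mulr0 mul0r.
  have s0 : Num.sqrt (m 0 j) != 0 by rewrite gt_eqF // sqrtr_gt0.
  have := sqr_sqrtr (ltW (m0 j)); move: s0; set s := Num.sqrt _ => s0 <-.
  by rewrite !mulr1n; field.
pose C' := D *m U *m C *m (D *m U)^T.
have symC' : C'^T = C' by rewrite /C' trmx_mul trmxK trmx_mul symC !mulmxA.
have [V [l [VV VC]]] := sym_spectral symC'.
exists (V *m (D *m U)), l; rewrite trmx_mul !mulmxA; split.
  by rewrite -(mulmxA V) -(mulmxA V) -(mulmxA V) DBD mulmx1.
by rewrite -(mulmxA V) -(mulmxA V) -(mulmxA V) -VC /C' !mulmxA.
Qed.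

End Spectral.

(** * The function zeta *)

Section Zeta.
Variable R : realType.
Implicit Types t r a b : R.

Lemma zeta_ge0 t : -1 < t -> 0 <= zeta t.
Proof. by move=> t1; rewrite subr_ge0 le_ln1Dx. Qed.

(** Parametrizing the segment from 0 to t as s * t puts the sign of t into the hypothesis, so that
    later uses treat t > 0 and t < 0 at once. *)
Lemma le_of_derive_along (f df : R -> R) t :
  (forall s : R, 0 <= s <= 1 -> is_derive (s * t) 1 f (df (s * t))) ->
  (forall s : R, 0 <= s <= 1 -> 0 <= df (s * t) * t) -> f 0 <= f t.
Proof.
move=> Hd Hs; have [->//|t0] := eqVneq t 0.
have par x : Num.min 0 t <= x <= Num.max 0 t -> exists2 s : R, 0 <= s <= 1 & x = s * t.
  move=> hx; exists (x / t); last by field.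
  move: hx; case: (ltgtP 0 t) t0 => // t0 _ /andP[x1 x2].
    by apply/andP; split; [apply: divr_ge0 => //; exact: ltW | rewrite ler_pdivrMr // mul1r].
  by rewrite ler_ndivrMr // mul1r x1 andbT ler_ndivlMr // mul0r.
have drv x : Num.min 0 t <= x <= Num.max 0 t -> is_derive x 1 f (df x).
  by move=> /par[s s01 ->]; exact: Hd.
have cont : {within `[Num.min 0 t, Num.max 0 t], continuous f}.
  suff dv : {in `[Num.min 0 t, Num.max 0 t]%R, forall x, derivable f x 1}.
    exact: (derivable_within_continuous dv).
  by move=> x /itvP h; have := drv x; rewrite !h => /(_ isT) [].
have lt01 : Num.min 0 t < Num.max 0 t by case: (ltgtP 0 t) t0.
have drv' x : x \in `]Num.min 0 t, Num.max 0 t[%R -> is_derive x 1 f (df x).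
  by rewrite in_itv /= => /andP[x1 x2]; apply: drv; rewrite !ltW.
have [c] := MVT lt01 drv' cont.
rewrite in_itv /= => /andP[c1 c2].
have /par[s s01 ->] : Num.min 0 t <= c <= Num.max 0 t by rewrite !ltW.
by have := Hs s s01; case: (ltgtP 0 t) t0 => // t0 _ h e; lra.
Qed.

Lemma is_derive_ln1D (x : R) : -1 < x ->
  is_derive x 1 (fun y : R => ln (1 + y)) (1 + x)^-1.
Proof.
move=> x1; have x0 : 0 < 1 + x by lra.
have d1 : is_derive x 1 (fun y : R => 1 + y) 1.
  by have := is_deriveD (is_derive_cst (1 : R) x 1) (is_derive_id x 1); rewrite add0r.
have d2 := is_derive1_ln x0.
by have := is_derive1_comp d2 d1; rewrite mulr1.
Qed.

Lemma is_derive_zeta (x : R) : -1 < x -> is_derive x 1 (@zeta R) (x / (1 + x)).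
Proof.
move=> x1; have d := is_derive_ln1D x1.
have -> : x / (1 + x) = 1 - (1 + x)^-1 by field; lra.
exact: (is_deriveB (is_derive_id x 1) d).
Qed.

Lemma zeta0 : zeta 0 = 0 :> R.
Proof. by rewrite /zeta addr0 ln1 subr0. Qed.

(** The derivative at x is x (2 a + b / (1 + x)); at x = s t, multiplied by t, it is s t^2 times the
    bracket. All quadratic bounds on [zeta], upper and lower, are choices of a and b. *)
Lemma quad_zeta_ge0 a b t : -1 < t ->
  (forall s, 0 <= s <= 1 -> 0 <= a * 2 + b / (1 + s * t)) ->
  0 <= a * t ^+ 2 + b * zeta t.
Proof.
move=> t1 h; pose f (x : R) := a * x ^+ 2 + b * zeta x.
have sm s : 0 <= s <= 1 -> -1 < s * t.
  by move=> /andP[s0 s1]; case: (lerP 0 t) => ht; nra.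
have -> : 0 = f 0 by rewrite /f zeta0 expr0n !mulr0 addr0.
apply: (@le_of_derive_along f (fun x => x * (a * 2 + b / (1 + x)))) => s s01.
  have d := is_derive_zeta (sm s s01); have := sm s s01; move: (s * t) d => x d x1.
  have d2 := is_deriveD (is_deriveZ a (is_deriveX 2 (is_derive_id x 1))) (is_deriveZ b d).
  apply: (is_derive_eq d2); rewrite /GRing.scale /=.
  by field; lra.
rewrite mulrAC mulr_ge0 ?h // -mulrA mulr_ge0 //; first by case/andP: s01.
by rewrite -expr2 sqr_ge0.
Qed.

Lemma zeta_le_sqr t : - 2^-1 <= t -> zeta t <= t ^+ 2.
Proof.
move=> ht; have := @quad_zeta_ge0 1 (-1) t; rewrite !mul1r mulN1r subr_ge0; apply.
  by lra.
move=> s /andP[s0 s1]; have h : 2^-1 <= 1 + s * t by nra.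
by rewrite mulN1r subr_ge0 invf_ple ?posrE //; lra.
Qed.

Lemma zeta_ge_quad t : -1 < t <= 2^-1 -> 2 / 9 * t ^+ 2 <= zeta t.
Proof.
move=> /andP[t1 t2]; suff : 0 <= - (2 / 9) * t ^+ 2 + 1 * zeta t by lra.
apply: quad_zeta_ge0 => //.
move=> s /andP[s0 s1]; have h : 1 + s * t <= 3 / 2 by nra.
have h0 : 0 < 1 + s * t by case: (lerP 0 t) => ht; nra.
suff : 2 / 3 <= (1 + s * t)^-1 by rewrite mul1r; lra.
by rewrite (_ : 2 / 3 = (3 / 2)^-1) ?lef_pV2 ?posrE //; lra.
Qed.

Lemma zeta_le_half_sqr t : 0 <= t -> zeta t <= t ^+ 2 / 2.
Proof.
move=> t0; suff : 0 <= 2^-1 * t ^+ 2 + (-1) * zeta t by lra.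
apply: quad_zeta_ge0; first by lra.
move=> s /andP[s0 s1]; have h : 1 <= 1 + s * t by nra.
rewrite mulN1r mulVf // subr_ge0 invf_le1 //; lra.
Qed.

Lemma zeta_opp r : 0 <= r < 1 -> zeta r <= zeta (- r).
Proof.
move=> /andP[r0 r1]; pose f (x : R) := zeta (- x) - zeta x.
rewrite -subr_ge0 (_ : 0 = f 0); last by rewrite /f oppr0 subrr.
apply: (@le_of_derive_along f (fun x => x / (1 - x) - x / (1 + x))) => s /andP[s0 s1].
  have x1 : -1 < s * r by nra.
  have x2 : s * r < 1 by nra.
  have x3 : -1 < - (s * r) by lra.
  have d1 := is_derive_zeta x1; have d2 := is_derive_zeta x3.
  move: (s * r) x1 x2 x3 d1 d2 => x x1 x2 x3 d1 d2.
  have d3 : is_derive x 1 (fun y : R => zeta (- y)) (- x / (1 - x) * -1).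
    have d4 : is_derive x 1 (fun y : R => - y) (-1) by apply: is_deriveNid.
    exact: is_derive1_comp d2 d4.
  have := is_deriveB d3 d1; rewrite mulrN1 mulNr opprK.
  exact.
have x0 : 0 <= s * r by nra.
have x2 : s * r < 1 by nra.
rewrite mulr_ge0 // subr_ge0 ler_wpM2l // lef_pV2 ?posrE; lra.
Qed.

(** The tangent line inequality of the convex function [zeta], obtained from ln (1 + u) <= u at u =
    (b - a) / (1 + a). *)
Lemma zeta_diff_ge a b : -1 < a -> -1 < b ->
  (b - a) * (a / (1 + a)) <= zeta b - zeta a.
Proof.
move=> a1 b1; have ha : 0 < 1 + a by lra.
have hu : -1 < (b - a) / (1 + a) by rewrite ltr_pdivlMr //; lra.
have := le_ln1Dx hu.
have -> : 1 + (b - a) / (1 + a) = (1 + b) / (1 + a) by field; lra.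
rewrite ln_div ?posrE //; last by lra.
have e : (b - a) * (a / (1 + a)) = (b - a) - (b - a) / (1 + a) by field; lra.
rewrite /zeta; lra.
Qed.

Lemma zeta_lt a b : 0 <= a < b -> zeta a < zeta b.
Proof.
(* At a = 0 the tangent has slope 0 and gives no strict growth; the tangent at the midpoint has
   positive slope. *)
move=> /andP[a0 ab]; pose m := (a + b) / 2.
have am : a < m by rewrite /m; lra.
have mb : m < b by rewrite /m; lra.
have a1 : -1 < a by lra.
have m1 : -1 < m by lra.
have b1 : -1 < b by lra.
have h1 := zeta_diff_ge a1 m1; have h2 := zeta_diff_ge m1 b1.
have h3 : 0 <= (m - a) * (a / (1 + a)).
  by apply: mulr_ge0; [lra | apply: divr_ge0; lra].
have h4 : 0 < (b - m) * (m / (1 + m)).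
  by apply: mulr_gt0; [lra | apply: divr_gt0; lra].
lra.
Qed.

(** The passage from function values to eigenvalues. One threshold serves both signs of t because
    zeta r <= zeta (- r). *)
Lemma zeta_le_norm t r : -1 < t -> 0 <= r < 1 -> zeta t <= zeta r -> `|t| <= r.
Proof.
move=> t1 /andP[r0 r1]; apply: contraTT; rewrite -!ltNge => h.
case: (lerP 0 t) h => t0 h.
  by apply: zeta_lt; rewrite r0 -(ger0_norm t0).
have t2 : 0 <= - t < 1 by lra.
have := zeta_opp t2; rewrite opprK; apply: lt_le_trans.
by apply: zeta_lt; rewrite r0 -(ltr0_norm t0).
Qed.

Lemma zeta_gt0 r : 0 < r -> 0 < zeta r.
Proof. by move=> r0; rewrite -zeta0; apply: zeta_lt; rewrite lexx. Qed.

End Zeta.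

(** * Information matrices in a common frame *)

Section Frames.
Variables (R : realType) (n d : nat) (A : 'M[R]_(n, d)).
Implicit Types (p q x z : 'rV[R]_n) (B : 'M[R]_(n, d)) (l : 'rV[R]_d).

Definition cross p i j : R :=
  (row i A *m invmx (infoM A p) *m (row j A)^T) 0 0.

(** The second derivative of [fdes] at p in direction x, that is, the trace of the square of M(p)^-1
    M(x), expanded so as to match the entries of [Hhat]. *)
Definition qform p x : R :=
  \sum_i \sum_j x 0 i * x 0 j * cross p i j ^+ 2.

Lemma lev_cross p i : lev A p i = cross p i i. Proof. by []. Qed.

Lemma infoME p : infoM A p = A^T *m diag_mx p *m A.
Proof.
apply/matrixP => k k'; rewrite summxE mxE; apply: eq_bigr => i _.
by rewrite mul_mx_diag !mxE big_ord1 !mxE; ring.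
Qed.

Lemma infoM_sym p : (infoM A p)^T = infoM A p.
Proof. by rewrite infoME !trmx_mul tr_diag_mx trmxK mulmxA. Qed.

Lemma infoMD p q : infoM A (p + q) = infoM A p + infoM A q.
Proof. by rewrite !infoME linearD /= mulmxDr mulmxDl. Qed.

Lemma infoMZ a p : infoM A (a *: p) = a *: infoM A p.
Proof. by rewrite !infoME linearZ /= -scalemxAr -scalemxAl. Qed.

Lemma infoM_delta j : infoM A (delta_mx 0 j) = (row j A)^T *m row j A.
Proof.
rewrite /infoM (bigD1 j) //= mxE !eqxx scale1r big1 ?addr0 // => i ij.
by rewrite mxE (negbTE ij) andbF scale0r.
Qed.

Lemma congr_infoM (W : 'M[R]_d) p k k' :
  (W *m infoM A p *m W^T) k k' =
  \sum_i p 0 i * (A *m W^T) i k * (A *m W^T) i k'.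
Proof.
have -> : W *m infoM A p *m W^T = (A *m W^T)^T *m diag_mx p *m (A *m W^T).
  by rewrite infoME trmx_mul trmxK !mulmxA.
rewrite mxE; apply: eq_bigr => i _.
rewrite mul_mx_diag; move: (A *m W^T) => Z; rewrite !mxE; ring.
Qed.

Lemma congr1_unit (W M : 'M[R]_d) : W *m M *m W^T = 1%:M ->
  W \in unitmx /\ invmx M = W^T *m W.
Proof.
move=> e; have e1 : W *m (M *m W^T) = 1%:M by rewrite mulmxA.
have [uW _] := mulmx1_unit e1; split=> //.
have e2 := mulmx1C e1; rewrite -mulmxA in e2.
have [uM _] := mulmx1_unit e2.
by rewrite -[LHS]mulmx1 -e2 mulKmx.
Qed.

Lemma congr_diag_inv (W M : 'M[R]_d) l : W *m M *m W^T = diag_mx l ->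
  (forall k, 0 < l 0 k) ->
  invmx M = W^T *m diag_mx (\row_k (l 0 k)^-1) *m W.
Proof.
move=> e l0; set D := diag_mx _.
have e1 : (D *m W) *m (M *m W^T) = 1%:M.
  rewrite -mulmxA (mulmxA W) e; apply/matrixP => i j.
  rewrite mul_diag_mx !mxE; case: eqP => [->|_]; last by rewrite !mulr0n mulr0.
  by rewrite !mulr1n mulVf // gt_eqF.
have e2 := mulmx1C e1; rewrite -mulmxA in e2.
have [uM _] := mulmx1_unit e2.
by rewrite -[LHS]mulmx1 -e2 mulKmx // mulmxA.
Qed.

Lemma congr_cross (W : 'M[R]_d) l i j :
  (row i A *m (W^T *m diag_mx l *m W) *m (row j A)^T) 0 0 =
  \sum_k (A *m W^T) i k * (A *m W^T) j k * l 0 k.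
Proof.
have -> : row i A *m (W^T *m diag_mx l *m W) *m (row j A)^T =
    row i (A *m W^T) *m diag_mx l *m (row j (A *m W^T))^T.
  by rewrite !row_mul trmx_mul trmxK !mulmxA.
move: (A *m W^T) => Z; rewrite mxE; apply: eq_bigr => k _.
by rewrite mul_mx_diag !mxE; ring.
Qed.

Lemma posdef_det_gt0 (M : 'M[R]_d) : posdef M -> 0 < \det M.
Proof.
move=> pM; have [W [l [e _]]] := pencil_spectral pM (trmx0 R d d).
have := congr1 determinant e; rewrite !det_mulmx det_tr det1 => h.
have h2 : \det W ^+ 2 * \det M = 1 by rewrite -h; ring.
have : 0 < \det W ^+ 2 * \det M by rewrite h2.
have := sqr_ge0 (\det W); rewrite le_eqVlt => /orP[/eqP <-|w0]; first by rewrite mul0r ltxx.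
by rewrite pmulr_rgt0.
Qed.

(* B lists the rows of A in coordinates for which M(p) is the identity and
   M(q) = diag l. *)
Definition frame p q B l : Prop :=
  [/\ (forall i j, cross p i j = \sum_k B i k * B j k),
      (forall k k', \sum_i p 0 i * B i k * B i k' = (k == k')%:R),
      (forall k k', \sum_i q 0 i * B i k * B i k' = l 0 k *+ (k == k')) &
      [/\ posdef (infoM A q) <-> (forall k, 0 < l 0 k),
          ((forall k, 0 < l 0 k) ->
             forall i j, cross q i j = \sum_k B i k * B j k / l 0 k),
          \det (infoM A q) = \det (infoM A p) * \prod_k l 0 k &
          forall x, (forall k k', \sum_i x 0 i * B i k * B i k' = 0) ->
            infoM A x = 0]].

(** Only M(p) has to be positive definite: q may have negative entries, and the definiteness of M(q)
    is read off the signs of l. This is what later admits the extrapolated points of FISTA. *)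
Lemma frame_exists p q : posdef (infoM A p) -> exists B l, frame p q B l.
Proof.
move=> pp; have [W [l [e1 e2]]] := pencil_spectral pp (infoM_sym q).
have [uW invp] := congr1_unit e1.
exists (A *m W^T), l; split.
- move=> i j; have invp1 : invmx (infoM A p) = W^T *m diag_mx (const_mx 1) *m W.
    by rewrite diag_const_mx mulmx1.
  rewrite /cross invp1 congr_cross.
  by apply: eq_bigr => k _; rewrite [X in _ * X]mxE mulr1.
- by move=> k k'; rewrite -congr_infoM e1 mxE.
- by move=> k k'; rewrite -congr_infoM e2 mxE.
split.
- split=> [[_ pq] k|l0].
    have := pq (delta_mx 0 k *m W) _; rewrite trmx_mul !mulmxA.
    rewrite -(mulmxA _ W) -(mulmxA _ (W *m _)) e2 diag_mx_quad (bigD1 k) //=.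
    rewrite mxE !eqxx expr1n mulr1 big1 ?addr0; last first.
      by move=> j jk; rewrite mxE (negbTE jk) andbF expr0n mulr0.
    apply; apply/eqP => /(congr1 (mulmx^~ (invmx W))); rewrite mul0mx mulmxK //.
    by move=> /rowP/(_ k)/eqP; rewrite !mxE !eqxx oner_eq0.
  split; first exact: infoM_sym.
  move=> x x0; pose y := x *m invmx W.
  have -> : x = y *m W by rewrite mulmxKV.
  rewrite trmx_mul !mulmxA -(mulmxA _ W) -(mulmxA _ (W *m _)) e2 diag_mx_quad.
  have y0 : y != 0.
    by apply: contra_neq x0 => y0; rewrite -[x](mulmxKV uW) -/y y0 mul0mx.
  have ge0 k : 0 <= l 0 k * y 0 k ^+ 2 by rewrite mulr_ge0 ?sqr_ge0 ?ltW.
  rewrite lt_neqAle sumr_ge0 // andbT eq_sym; apply: contra_neq y0 => /eqP.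
  rewrite psumr_eq0 // => /allP h; apply/rowP => k; rewrite [RHS]mxE.
  have := h k (mem_index_enum _); rewrite /= mulf_eq0 (gt_eqF (l0 k)) /=.
  by rewrite expf_eq0 => /eqP.
- move=> l0 i j; rewrite /cross (congr_diag_inv e2 l0) congr_cross.
  by apply: eq_bigr => k _; rewrite [X in _ * X]mxE.
- have := congr1 determinant e1; have := congr1 determinant e2.
  rewrite !det_mulmx det_tr det1 det_diag => <- h.
  by rewrite -[LHS]mul1r -h; ring.
- move=> x h; suff e : W *m infoM A x *m W^T = 0.
    have := congr1 (fun Z => invmx W *m Z *m invmx W^T) e; rewrite mulmx0 mul0mx.
    by rewrite !mulmxA mulVmx // mul1mx mulmxK // unitmx_tr.
  by apply/matrixP => k k'; rewrite congr_infoM h mxE.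
Qed.

End Frames.

Section FrameTheory.
Variables (R : realType) (n d : nat) (A : 'M[R]_(n, d)).
Implicit Types (p q x z : 'rV[R]_n) (B : 'M[R]_(n, d)) (l : 'rV[R]_d).

Let gram x B k k' : R := \sum_i x 0 i * B i k * B i k'.

(** In a frame, [qform] is the squared Frobenius norm of M(x), hence nonnegative and zero only if
    M(x) = 0. *)
Lemma qform_gram p B x :
  (forall i j, cross A p i j = \sum_k B i k * B j k) ->
  qform A p x = \sum_k \sum_k' gram x B k k' ^+ 2.
Proof.
move=> h; rewrite /qform pair_bigA /= [RHS]pair_bigA /=.
transitivity (\sum_(ij : 'I_n * 'I_n) \sum_(kk : 'I_d * 'I_d)
  (x 0 ij.1 * B ij.1 kk.1 * B ij.1 kk.2) * (x 0 ij.2 * B ij.2 kk.1 * B ij.2 kk.2)).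
  apply: eq_bigr => -[i j] _ /=; rewrite h expr2 big_distrlr /= pair_bigA /= mulr_sumr.
  by apply: eq_bigr => kk _; ring.
rewrite exchange_big /=; apply: eq_bigr => -[k k'] _ /=.
by rewrite /gram expr2 big_distrlr /= pair_bigA.
Qed.

Lemma sum_lev_gram p B x :
  (forall i j, cross A p i j = \sum_k B i k * B j k) ->
  \sum_i x 0 i * lev A p i = \sum_k gram x B k k.
Proof.
move=> h; rewrite exchange_big /=; apply: eq_bigr => i _.
by rewrite lev_cross h mulr_sumr; apply: eq_bigr => k _; rewrite mulrA.
Qed.

Lemma gram_diff p q B l k k' : frame A p q B l ->
  gram (q - p) B k k' = (l 0 k - 1) *+ (k == k').
Proof.
case=> _ hp hq _; rewrite mulrnBl -hq -hp -sumrB.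
by apply: eq_bigr => i _; rewrite !mxE; ring.
Qed.

Lemma qform_diff p q B l : frame A p q B l ->
  qform A p (q - p) = \sum_k (l 0 k - 1) ^+ 2.
Proof.
move=> fr; case: (fr) => h _ _ _; rewrite (qform_gram _ h); apply: eq_bigr => k _.
rewrite (bigD1 k) //= big1 ?addr0 => [|k' kk']; first by rewrite (gram_diff _ _ fr) eqxx.
by rewrite (gram_diff _ _ fr) eq_sym (negbTE kk') expr0n.
Qed.

Lemma qform_ge0 p x : posdef (infoM A p) -> 0 <= qform A p x.
Proof.
move=> /(frame_exists p)[B [l [h _ _ _]]]; rewrite (qform_gram _ h).
by apply: sumr_ge0 => k _; apply: sumr_ge0 => k' _; exact: sqr_ge0.
Qed.

Lemma qform_eq0 p x : posdef (infoM A p) -> qform A p x = 0 -> infoM A x = 0.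
Proof.
move=> /(frame_exists p)[B [l [h _ _ [_ _ _ h0]]]]; rewrite (qform_gram _ h) => /eqP.
rewrite psumr_eq0 => [/allP e|k _]; last by apply: sumr_ge0 => k' _; exact: sqr_ge0.
apply: h0 => k k'; have := e k (mem_index_enum _); rewrite /= psumr_eq0 => [/allP e'|j _]; last exact: sqr_ge0.
by have := e' k' (mem_index_enum _); rewrite /= expf_eq0 => /eqP.
Qed.

Lemma lev_ge0 p i : posdef (infoM A p) -> 0 <= lev A p i.
Proof.
move=> /(frame_exists p)[B [l [h _ _ _]]]; rewrite lev_cross h.
by apply: sumr_ge0 => k _; rewrite -expr2 sqr_ge0.
Qed.

Lemma sum_lev p : posdef (infoM A p) -> \sum_i p 0 i * lev A p i = d%:R.
Proof.
move=> /(frame_exists p)[B [l [h hp _ _]]]; rewrite (sum_lev_gram _ h).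
by under eq_bigr => k _ do rewrite /gram hp eqxx; rewrite sumr_const card_ord.
Qed.

Lemma ln_prod (I : finType) (f : I -> R) : (forall i, 0 < f i) ->
  ln (\prod_i f i) = \sum_i ln (f i).
Proof.
move=> f0; suff [] : 0 < \prod_i f i /\ ln (\prod_i f i) = \sum_i ln (f i) by [].
elim/big_ind2 : _ => [|x1 x2 y1 y2 [h1 <-] [h2 <-]|i _]; rewrite ?ln1 ?ltr01 //.
by rewrite mulr_gt0 // lnM ?posrE.
Qed.

(** The gradient of [fdes] at p is minus the vector of leverage scores, hence the plus sign. *)
Definition bregman p q : R :=
  fdes A q - fdes A p + \sum_i (q 0 i - p 0 i) * lev A p i.

Lemma bregman_frame p q B l : posdef (infoM A p) -> posdef (infoM A q) ->
  frame A p q B l ->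
  (forall k, 0 < l 0 k) /\ bregman p q = \sum_k zeta (l 0 k - 1).
Proof.
move=> pp pq fr; case: (fr) => h _ _ [pql _ hdet _].
have l0 := proj1 pql pq; split=> //.
have -> : bregman p q = fdes A q - fdes A p + \sum_k gram (q - p) B k k.
  rewrite -(sum_lev_gram _ h); congr (_ + _); apply: eq_bigr => i _.
  by rewrite !mxE.
have -> : fdes A q - fdes A p = - \sum_k ln (l 0 k).
  rewrite /fdes hdet lnM ?posrE ?posdef_det_gt0 ?prodr_gt0 // ln_prod //; ring.
rewrite -sumrN -big_split /=; apply: eq_bigr => k _.
by rewrite (gram_diff _ _ fr) eqxx /zeta addrC (addrC 1) subrK.
Qed.

Lemma bregman_ge0 p q : posdef (infoM A p) -> posdef (infoM A q) ->
  0 <= bregman p q.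
Proof.
move=> pp pq; have [B [l fr]] := frame_exists q pp.
have [l0 ->] := bregman_frame pp pq fr.
by apply: sumr_ge0 => k _; apply: zeta_ge0; have := l0 k; lra.
Qed.

Lemma frame_near p q B l r : frame A p q B l -> 0 <= r ->
  qform A p (q - p) <= r ^+ 2 -> forall k, `|l 0 k - 1| <= r.
Proof.
move=> fr r0; rewrite (qform_diff fr) => h k.
rewrite -ler_sqr ?nnegrE // real_normK ?num_real //; apply: le_trans h.
by rewrite (bigD1 k) //= lerDl sumr_ge0 // => j _; exact: sqr_ge0.
Qed.

(** Dikin ellipsoid: at local distance r < 1, every eigenvalue of M(q) relative to M(p) is at least
    1 - r. *)
Lemma posdef_near p q r : posdef (infoM A p) -> 0 <= r < 1 ->
  qform A p (q - p) <= r ^+ 2 -> posdef (infoM A q).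
Proof.
move=> pp /andP[r0 r1] h; have [B [l fr]] := frame_exists q pp.
have hl := frame_near fr r0 h; case: fr => _ _ _ [-> _ _ _] k.
by have := hl k; rewrite ler_norml; lra.
Qed.

Lemma bregman_le_qform p q : posdef (infoM A p) -> posdef (infoM A q) ->
  qform A p (q - p) <= 1 / 4 -> bregman p q <= qform A p (q - p).
Proof.
move=> pp pq h; have [B [l fr]] := frame_exists q pp.
have [l0 ->] := bregman_frame pp pq fr.
have hr : qform A p (q - p) <= (1 / 2) ^+ 2 by lra.
have r0 : 0 <= 1 / 2 :> R by lra.
have hl := frame_near fr r0 hr.
rewrite (qform_diff fr); apply: ler_sum => k _; apply: zeta_le_sqr.
by have := hl k; rewrite ler_norml; lra.
Qed.

Lemma frame_bregman_near p q B l r : posdef (infoM A p) -> posdef (infoM A q) ->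
  frame A p q B l -> 0 <= r < 1 -> bregman p q <= zeta r ->
  forall k, `|l 0 k - 1| <= r.
Proof.
move=> pp pq fr r01 h k; have [l0 e] := bregman_frame pp pq fr.
have l1 j : -1 < l 0 j - 1 by have := l0 j; lra.
apply: zeta_le_norm => //; apply: le_trans h; rewrite e (bigD1 k) //= lerDl.
by apply: sumr_ge0 => j _; exact: zeta_ge0.
Qed.

Lemma qform_le_bregman p q r : posdef (infoM A p) -> posdef (infoM A q) ->
  0 <= r <= 1 / 2 -> bregman p q <= zeta r ->
  2 / 9 * qform A p (q - p) <= bregman p q.
Proof.
move=> pp pq /andP[r0 r1] h; have [B [l fr]] := frame_exists q pp.
have r01 : 0 <= r < 1 by lra.
have hl := frame_bregman_near pp pq fr r01 h.
have [l0 ->] := bregman_frame pp pq fr.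
rewrite (qform_diff fr) mulr_sumr; apply: ler_sum => k _; apply: zeta_ge_quad.
by have := l0 k; have := hl k; rewrite ler_norml; lra.
Qed.

(** A small divergence forces all l_k into [1 - r, 1 + r], and the leverage score at q is the sum of
    B_ik^2 / l_k. *)
Lemma lev_le_bregman p q r i : posdef (infoM A p) -> posdef (infoM A q) ->
  0 <= r < 1 -> bregman p q <= zeta r ->
  lev A q i <= lev A p i / (1 - r) /\ lev A p i / (1 + r) <= lev A q i.
Proof.
move=> pp pq r01 h; have [B [l fr]] := frame_exists q pp.
have hl := frame_bregman_near pp pq fr r01 h.
have [l0 _] := bregman_frame pp pq fr.
case: fr => hp _ _ [_ /(_ l0) hq _ _]; rewrite !lev_cross hp hq !mulr_suml.
case/andP: r01 => r0 r1.
split; apply: ler_sum => k _; apply: ler_wpM2l; rewrite -?expr2 ?sqr_ge0 //;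
  by rewrite lef_pV2 ?posrE //; have := hl k; rewrite ler_norml; lra.
Qed.

(** The left side pairs the diagonal of the Gram matrix of z with (1 - l_k) / l_k, which is at most
    2 |l_k - 1| as l_k >= 1/2; Cauchy-Schwarz does the rest. The test vector z will be the gradient
    or a basis vector. *)
Lemma lev_lipschitz p q z : posdef (infoM A p) -> qform A p (q - p) <= 1 / 4 ->
  (\sum_i z 0 i * (lev A q i - lev A p i)) ^+ 2 <=
  4 * qform A p z * qform A p (q - p).
Proof.
move=> pp h; have [B [l fr]] := frame_exists q pp.
have hr : qform A p (q - p) <= (1 / 2) ^+ 2 by lra.
have r0 : 0 <= 1 / 2 :> R by lra.
have hl := frame_near fr r0 hr.
have l0 k : 0 < l 0 k by have := hl k; rewrite ler_norml; lra.
rewrite (qform_diff fr); case: fr => hp _ _ [_ /(_ l0) hq _ _].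
have -> : \sum_i z 0 i * (lev A q i - lev A p i) =
    \sum_k gram z B k k * ((1 - l 0 k) / l 0 k).
  under eq_bigr => i _ do rewrite !lev_cross hp hq -sumrB mulr_sumr.
  rewrite exchange_big /=; apply: eq_bigr => k _.
  rewrite /gram mulr_suml; apply: eq_bigr => i _.
  by have := l0 k => lk; field; rewrite gt_eqF.
apply: le_trans (sum_cauchy_schwarz _ _) _.
have -> (a b : R) : 4 * a * b = a * (4 * b) by ring.
apply: ler_pM.
- by apply: sumr_ge0 => k _; exact: sqr_ge0.
- by apply: sumr_ge0 => k _; exact: sqr_ge0.
- rewrite (qform_gram _ hp); apply: ler_sum => k _.
  by rewrite (bigD1 k) //= lerDl sumr_ge0 // => k' _; exact: sqr_ge0.
- rewrite mulr_sumr; apply: ler_sum => k _; rewrite expr_div_n.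
  rewrite ler_pdivrMr ?exprn_gt0 //.
  have := hl k; rewrite ler_norml => /andP[h1 h2].
  have : 1 <= 4 * l 0 k ^+ 2 by nra.
  have := sqr_ge0 (1 - l 0 k); nra.
Qed.

Lemma qform_near p q x : posdef (infoM A p) -> qform A p (q - p) <= 1 / 16 ->
  qform A q x <= 2 * qform A p x.
Proof.
move=> pp h; have [B [l fr]] := frame_exists q pp.
have hr : qform A p (q - p) <= (1 / 4) ^+ 2 by lra.
have r0 : 0 <= 1 / 4 :> R by lra.
have hl := frame_near fr r0 hr.
have l0 k : 0 < l 0 k by have := hl k; rewrite ler_norml; lra.
case: fr => hp _ _ [_ /(_ l0) hq _ _].
(* Rescaling column k by l_k^(-1/2) gives coordinates in which M(q) is the identity. Since l_k >=
   3/4, each Gram entry squared grows by at most 16/9 <= 2. *)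
pose B' : 'M[R]_(n, d) := \matrix_(i, k) (B i k / Num.sqrt (l 0 k)).
have s0 k : Num.sqrt (l 0 k) != 0 by rewrite gt_eqF // sqrtr_gt0.
have hB' i j : cross A q i j = \sum_k B' i k * B' j k.
  rewrite hq; apply: eq_bigr => k _; rewrite !mxE.
  have := sqr_sqrtr (ltW (l0 k)); move: (s0 k); set s := Num.sqrt _ => sk <-.
  by field.
rewrite (qform_gram _ hp) (qform_gram _ hB') mulr_sumr; apply: ler_sum => k _.
rewrite mulr_sumr; apply: ler_sum => k' _.
have -> : gram x B' k k' ^+ 2 = gram x B k k' ^+ 2 / (l 0 k * l 0 k').
  have -> : gram x B' k k' = gram x B k k' / (Num.sqrt (l 0 k) * Num.sqrt (l 0 k')).
    rewrite /gram mulr_suml; apply: eq_bigr => i _; rewrite !mxE.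
    by have := s0 k; have := s0 k' => ? ?; field; apply/andP.
  by rewrite expr_div_n exprMn !sqr_sqrtr // ltW.
rewrite ler_pdivrMr ?mulr_gt0 //.
have := hl k; have := hl k'; rewrite !ler_norml => /andP[a1 a2] /andP[b1 b2].
have : 1 <= 2 * (l 0 k * l 0 k') by nra.
have := sqr_ge0 (gram x B k k'); nra.
Qed.

End FrameTheory.

(** * Rayleigh quotients *)

Section Rayleigh.
Variable R : realType.

Lemma eigenrow n (H U : 'M[R]_n) l k : U *m U^T = 1%:M -> U *m H *m U^T = diag_mx l ->
  row k U *m H = l 0 k *: row k U.
Proof.
move=> UU UH; have UUt := mulmx1C UU.
have e : U *m H = diag_mx l *m U by rewrite -UH -!mulmxA UUt !mulmx1.
rewrite -row_mul e; apply/rowP => j.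
by rewrite mul_diag_mx !mxE.
Qed.

Lemma row_neq0 n (U : 'M[R]_n) k : U *m U^T = 1%:M -> row k U != 0.
Proof.
move=> UU; apply/eqP => h; have := congr1 (fun M : 'M[R]_n => row k M) UU.
by rewrite row_mul h mul0mx => /rowP/(_ k)/eqP; rewrite !mxE eqxx eq_sym oner_eq0.
Qed.

Lemma quad_spectral n (H U : 'M[R]_n) l x : U *m U^T = 1%:M ->
  U *m H *m U^T = diag_mx l ->
  dotv (x *m H) x = \sum_k l 0 k * dotv x (row k U) ^+ 2.
Proof.
move=> UU UH; have UUt := mulmx1C UU.
have e : H = U^T *m diag_mx l *m U.
  by rewrite -UH !mulmxA UUt mul1mx -mulmxA UUt mulmx1.
rewrite /dotv {1}e !mulmxA -(mulmxA _ U) -[U in U *m x^T]trmxK -trmx_mul diag_mx_quad.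
apply: eq_bigr => k _; congr (_ * _ ^+ 2); rewrite !mxE.
by apply: eq_bigr => j _; rewrite !mxE.
Qed.

Lemma dotv_spectral n (U : 'M[R]_n) x : U *m U^T = 1%:M ->
  dotv x x = \sum_k dotv x (row k U) ^+ 2.
Proof.
move=> UU; have := @quad_spectral n 1%:M U (const_mx 1) x UU.
rewrite !mulmx1 UU diag_const_mx => /(_ erefl) ->.
by apply: eq_bigr => k _; rewrite mxE mul1r.
Qed.

Lemma rayleigh_le_lambda_max n (H : 'M[R]_n) x : H^T = H ->
  dotv (x *m H) x <= lambda_max H * dotv x x.
Proof.
move=> symH; have [U [l [UU UH]]] := sym_spectral symH.
(* A crude bound, whose only purpose is to make the supremum in [lambda_max] meaningful. *)
have ub : ubound [set a | eigenvalue H a] (\sum_k `|l 0 k|).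
  move=> a /= /eigenvalueP[v vH v0]; have vv := dotv_gt0 v0.
  rewrite -(ler_pM2r vv) -dotvZl -vH (quad_spectral _ UU UH) (dotv_spectral _ UU).
  rewrite mulr_sumr; apply: ler_sum => k _; rewrite ler_wpM2r ?sqr_ge0 //.
  by rewrite (le_trans (ler_norm _)) // (bigD1 k) //= lerDl sumr_ge0.
rewrite (quad_spectral _ UU UH) (dotv_spectral _ UU) mulr_sumr.
apply: ler_sum => k _; rewrite ler_wpM2r ?sqr_ge0 //.
apply: ub_le_sup; first by exists (\sum_k `|l 0 k|).
by apply/eigenvalueP; exists (row k U); [exact: eigenrow | exact: row_neq0].
Qed.

Variables (n : nat) (S : {set 'I_n}).
Implicit Types x y z : 'rV[R]_n.

(* The orthogonal projector onto zero_sum S. *)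
Definition zproj : 'M[R]_n :=
  \matrix_(i, j) (if (i \in S) && (j \in S) then (i == j)%:R - #|S|%:R^-1 else 0).

Lemma zproj_sym : zproj^T = zproj.
Proof. by apply/matrixP => i j; rewrite !mxE andbC eq_sym. Qed.

Lemma zprojE x j : (x *m zproj) 0 j =
  if j \in S then x 0 j - (\sum_(i in S) x 0 i) / #|S|%:R else 0.
Proof.
rewrite mxE; case: ifPn => jS; last first.
  by apply: big1 => i _; rewrite mxE (negbTE jS) andbF mulr0.
transitivity (\sum_i (if i == j then x 0 j else 0) -
  \sum_i (if i \in S then x 0 i / #|S|%:R else 0)).
  rewrite -sumrB; apply: eq_bigr => i _; rewrite mxE jS andbT.
  case: eqVneq => [->|ij]; first by rewrite jS mulrBr mulr1.
  by case: ifP => _; rewrite /= !sub0r ?mulrN ?oppr0 ?mulr0.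
by rewrite -big_mkcond big_pred1_eq -big_mkcond -mulr_suml.
Qed.

Lemma supp_out x i : supp x \subset S -> i \notin S -> x 0 i = 0.
Proof. by move=> /fintype.subsetP h iS; apply/eqP; apply: contraNT iS => xi; apply: h; rewrite inE. Qed.

Lemma suppP x : (forall i, i \notin S -> x 0 i = 0) -> supp x \subset S.
Proof. by move=> h; apply/fintype.subsetP => i; rewrite inE; apply: contraNT => /h ->. Qed.

Lemma sum_supp x (f : 'I_n -> R) : supp x \subset S ->
  \sum_i x 0 i * f i = \sum_(i in S) x 0 i * f i.
Proof.
move=> sx; rewrite [RHS]big_mkcond; apply: eq_bigr => i _.
by case: ifPn => // iS; rewrite (supp_out sx) // mul0r.
Qed.

Lemma sum_supp1 x : supp x \subset S -> \sum_i x 0 i = \sum_(i in S) x 0 i.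
Proof.
move=> sx; have := sum_supp (fun=> 1) sx; under eq_bigr do rewrite mulr1.
by under [in RHS]eq_bigr do rewrite mulr1.
Qed.

Lemma zproj_zero_sum x : zero_sum S (x *m zproj).
Proof.
have sx : supp (x *m zproj) \subset S.
  by apply: suppP => i iS; rewrite zprojE (negbTE iS).
split=> //; rewrite (sum_supp1 sx).
under eq_bigr => i iS do rewrite zprojE iS.
rewrite sumrB sumr_const; have [S0|S0] := eqVneq #|S| 0%N.
  by rewrite S0 mulr0n subr0 big1 // => i iS; have := card0_eq S0 i; rewrite iS.
by rewrite -[X in _ - X]mulr_natr divfK ?subrr // pnatr_eq0.
Qed.

Lemma zproj_id x : zero_sum S x -> x *m zproj = x.
Proof.
move=> [sx x0]; apply/rowP => j; rewrite zprojE; case: ifPn => jS.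
  by rewrite -(sum_supp1 sx) x0 mul0r subr0.
by rewrite (supp_out sx).
Qed.

Lemma dotv_zproj x y : zero_sum S y -> dotv (x *m zproj) y = dotv x y.
Proof. by move=> hy; rewrite dotv_mulmx zproj_sym zproj_id. Qed.

(* An eigenvector w of zproj * H * zproj whose projection on zero_sum S is nonzero
   projects to an eigenvector of the compression, and the other ones are
   orthogonal to zero_sum S. *)
Lemma lambda_min_on_attained (H : 'M[R]_#|S|) : H^T = H ->
  zero_sum S <> [set (0 : 'rV[R]_n)] ->
  (exists x, [/\ zero_sum S x, x != 0 &
     dotv (restr S x *m H) (restr S x) = lambda_min_on H (zero_sum S) * dotv x x]) /\
  forall y, zero_sum S y ->
    lambda_min_on H (zero_sum S) * dotv y y <= dotv (restr S y *m H) (restr S y).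
Proof.
move=> symH T0.
have [x0 Tx0 x00] : exists2 x : 'rV[R]_n, zero_sum S x & x != 0.
  apply: contrapT => h; apply: T0; apply/seteqP; split => x /= Tx.
    by apply/eqP; apply: contrapT => /negP x0; apply: h; exists x.
  by rewrite Tx; split; [apply: suppP => i _; rewrite mxE | rewrite big1 // => i _; rewrite mxE].
pose E : 'M[R]_(n, #|S|) := \matrix_(i, j) (i == enum_val j)%:R.
have restrE x : restr S x = x *m E.
  apply/rowP => j; rewrite !mxE (bigD1 (enum_val j)) //= mxE eqxx mulr1.
  by rewrite big1 ?addr0 // => i ij; rewrite mxE (negbTE ij) mulr0.
have [H' H'E] : exists H', H' = E *m H *m E^T by exists (E *m H *m E^T).
have symH' : H'^T = H' by rewrite H'E !trmx_mul trmxK symH mulmxA.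
have HE x y : dotv (restr S x *m H) (restr S y) = dotv (x *m H') y.
  by rewrite !restrE /dotv H'E trmx_mul !mulmxA.
pose Bm := zproj *m H' *m zproj.
have symB : Bm^T = Bm by rewrite /Bm !trmx_mul symH' zproj_sym mulmxA.
have [U [l [UU UB]]] := sym_spectral symB.
pose w k := row k U *m zproj.
have wT k : zero_sum S (w k) by exact: zproj_zero_sum.
have wE k y : zero_sum S y -> dotv (w k *m H') y = l 0 k * dotv (w k) y.
  move=> Ty; rewrite -(dotv_zproj _ Ty) /w -[row k U *m zproj *m H' *m zproj]mulmxA.
  rewrite -[row k U *m _ *m _]mulmxA (mulmxA zproj) -/Bm (eigenrow k UU UB) dotvZl.
  by rewrite dotv_zproj.
have quadE y : zero_sum S y -> dotv (y *m H') y = \sum_k l 0 k * dotv y (w k) ^+ 2.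
  move=> Ty; have -> : dotv (y *m H') y = dotv (y *m Bm) y.
    by rewrite /Bm !mulmxA (zproj_id Ty) dotv_zproj.
  rewrite (quad_spectral _ UU UB); apply: eq_bigr => k _; congr (_ * _ ^+ 2).
  by rewrite dotvC -(dotv_zproj _ Ty) dotvC.
have normE y : zero_sum S y -> dotv y y = \sum_k dotv y (w k) ^+ 2.
  move=> Ty; rewrite (dotv_spectral _ UU); apply: eq_bigr => k _; congr (_ ^+ 2).
  by rewrite dotvC -(dotv_zproj _ Ty) dotvC.
have [k0 wk0] : exists k, w k != 0.
  apply: contrapT => h; move: x00; rewrite (dotv_eq0 (x := x0)) ?eqxx //.
  rewrite (normE _ Tx0) big1 // => k _; have -> : w k = 0.
    by apply/eqP; apply: contrapT => /negP wk; apply: h; exists k.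
  by rewrite dotvE big1 ?expr0n // => i _; rewrite mxE mulr0.
(* Rows of U with zero projection contribute nothing on [zero_sum S] and may carry a spurious small
   eigenvalue, so they are left out of the minimum. *)
have [km wkm kmin] : exists2 k, w k != 0 & forall j, w j != 0 -> l 0 k <= l 0 j.
  by case: (@arg_minP _ _ _ k0 (fun k => w k != 0) (l 0) wk0) => k hk h; exists k.
have low y : zero_sum S y -> l 0 km * dotv y y <= dotv (y *m H') y.
  move=> Ty; rewrite (quadE _ Ty) (normE _ Ty) mulr_sumr; apply: ler_sum => k _.
  have [wk|wk] := eqVneq (w k) 0; last by rewrite ler_wpM2r ?sqr_ge0 ?kmin.
  by rewrite wk dotvE big1 ?expr0n ?mulr0 // => i _; rewrite mxE mulr0.
have minE : lambda_min_on H (zero_sum S) = l 0 km.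
  rewrite /lambda_min_on; set X := [set a | _].
  have lbX : lbound X (l 0 km).
    move=> a [x [Tx xn0 hx]]; rewrite -(ler_pM2r (dotv_gt0 xn0)).
    by rewrite -(hx _ Tx) HE low.
  have Xk : X (l 0 km).
    by exists (w km); split=> // y Ty; rewrite HE wE.
  apply/le_anti/andP; split; first by apply: ge_inf => //; exists (l 0 km).
  by apply: lb_le_inf => //; exists (l 0 km).
rewrite minE; split; first by exists (w km); split=> //; rewrite HE wE.
by move=> y Ty; rewrite HE low.
Qed.

End Rayleigh.

(** * Euclidean projections *)

Section Projections.
Variables (R : realType) (n : nat).
Implicit Types (x y z : 'rV[R]_n) (C : set 'rV[R]_n) (S : {set 'I_n}).

Lemma row_subE x y i : (x - y) 0 i = x 0 i - y 0 i.
Proof. by rewrite !mxE. Qed.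

Lemma row_addE x y i : (x + y) 0 i = x 0 i + y 0 i.
Proof. by rewrite mxE. Qed.

Lemma row_scaleE a x i : (a *: x) 0 i = a * x 0 i.
Proof. by rewrite mxE. Qed.

Lemma zero_sumB S x y : supp x \subset S -> supp y \subset S ->
  \sum_i x 0 i = \sum_i y 0 i -> zero_sum S (x - y).
Proof.
move=> sx sy e; split.
  by apply: suppP => i iS; rewrite row_subE (supp_out sx iS) (supp_out sy iS) subrr.
by under eq_bigr do rewrite row_subE; rewrite sumrB e subrr.
Qed.

(** The obtuse-angle inequality bounds |y - z|^2 below by |y - x|^2 + |z - x|^2, so x is the unique
    nearest point and the choice made in [eproj] must return it. *)
Lemma eproj_eq C x y : C x -> (forall z, C z -> dotv (y - x) (z - x) <= 0) ->
  eproj C y = x.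
Proof.
move=> Cx h.
have key z : dotv (y - z) (y - z) =
    dotv (y - x) (y - x) - 2 * dotv (y - x) (z - x) + dotv (z - x) (z - x).
  by rewrite !(dotvBl, dotvBr) (dotvC z y) (dotvC x y) (dotvC z x); ring.
have px : is_proj C y x.
  split=> // z Cz; rewrite ler_enorm (key z).
  by have := h z Cz; have := dotv_ge0 (z - x); lra.
rewrite /eproj; case: xgetP => [x' _ [Cx' hx']|/(_ x) //].
have := hx' x Cx; rewrite ler_enorm (key x') => h1.
have h2 := h x' Cx'; have h3 := dotv_ge0 (x' - x).
by apply/eqP; rewrite -subr_eq0; apply/eqP/dotv_eq0; lra.
Qed.

Lemma eproj_zero_sum S y : eproj (zero_sum S) y = y *m zproj R S.
Proof.
apply: eproj_eq => [|z Tz]; first exact: zproj_zero_sum.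
have Tp := zproj_zero_sum S y.
have Td : zero_sum S (z - y *m zproj R S).
  by case: Tz => sz z0; case: Tp => sp p0; apply: zero_sumB; rewrite // z0 p0.
by rewrite dotvBl dotv_zproj // subrr.
Qed.

Lemma continuous_sum_maxr0 S y :
  continuous (fun t : R => \sum_(i in S) Num.max (y 0 i - t) 0).
Proof.
have add_cont : continuous (fun z : R * R => z.1 + z.2) by exact: add_continuous.
apply: (continuous_big add_cont) => i _ t.
apply: (@continuous_max _ _ (fun t : R => y 0 i - t) (fun=> 0)); last exact: cst_continuous.
by apply: cvgB; [exact: cvg_cst | exact: cvg_id].
Qed.

(* The projection onto the simplex subtracts a threshold t and truncates at 0. *)
Lemma eproj_face S y i0 : i0 \in S ->
  face S (eproj (face S) y) /\
  forall z, face S z -> dotv (y - eproj (face S) y) (z - eproj (face S) y) <= 0.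
Proof.
move=> i0S; pose g (t : R) := \sum_(i in S) Num.max (y 0 i - t) 0.
pose b := \sum_i `|y 0 i|.
have yb i : `|y 0 i| <= b by rewrite /b (bigD1 i) //= lerDl sumr_ge0.
have b0 : 0 <= b by apply: sumr_ge0.
have ga : 1 <= g (- b - 1).
  rewrite /g (bigD1 i0) //=; apply: (@le_trans _ _ (Num.max (y 0 i0 - (- b - 1)) 0)).
    by rewrite le_max; apply/orP; left; have := yb i0; rewrite ler_norml; lra.
  by rewrite lerDl sumr_ge0 // => i _; rewrite le_max lexx orbT.
have gb : g b = 0.
  rewrite /g big1 // => i _; apply/max_idPr.
  by have := yb i; rewrite ler_norml; lra.
have [t _ gt1] : exists2 t, t \in `[(- b - 1), b]%R & g t = 1.
  apply: IVT; first lra.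
    exact/continuous_subspaceT/continuous_sum_maxr0.
  by rewrite gb ge_min ler01 orbT /= le_max ga.
pose x : 'rV[R]_n := \row_i (if i \in S then Num.max (y 0 i - t) 0 else 0).
have Cx : face S x.
  split; last by apply: suppP => i iS; rewrite mxE (negbTE iS).
  split=> [i|]; first by rewrite mxE; case: ifP => // _; rewrite le_max lexx orbT.
  by under eq_bigr do rewrite mxE; rewrite -big_mkcond.
suff var z : face S z -> dotv (y - x) (z - x) <= 0 by rewrite (eproj_eq Cx).
move=> [[z0 z1] sz]; case: Cx => -[x0 x1] sx.
(* Both points have total weight 1, so the constant vector t is orthogonal to z - x; after adding it
   the inequality holds term by term. *)
have e : t * \sum_i (z - x) 0 i = 0.
  by under eq_bigr do rewrite row_subE; rewrite sumrB z1 x1 subrr mulr0.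
rewrite dotvE -[leRHS]e mulr_sumr; apply: ler_sum => i _.
have := z0 i; rewrite !row_subE.
rewrite [x 0 i]mxE; case: ifPn => iS zi; last by rewrite (supp_out sz iS) !subr0 !mulr0.
rewrite /Num.max; case: ltP => hm; nra.
Qed.

End Projections.

(** * The Hessian on the optimal face as a quadratic form *)

Section HhatTheory.
Variables (R : realType) (n d : nat) (A : 'M[R]_(n, d)).
Implicit Types (p ps x : 'rV[R]_n) (S : {set 'I_n}).

Lemma cross_sym p i j : cross A p i j = cross A p j i.
Proof.
rewrite /cross.
have -> : (row i A *m invmx (infoM A p) *m (row j A)^T) 0 0 =
    (row i A *m invmx (infoM A p) *m (row j A)^T)^T 0 0 by rewrite [RHS]mxE.
by rewrite !trmx_mul trmxK trmx_inv infoM_sym mulmxA.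
Qed.

Lemma HhatE S p i j : Hhat A S p i j = cross A p (enum_val i) (enum_val j) ^+ 2.
Proof. by rewrite /Hhat mxE. Qed.

Lemma Hhat_sym S p : (Hhat A S p)^T = Hhat A S p.
Proof. by apply/matrixP => i j; rewrite [LHS]mxE !HhatE cross_sym. Qed.

Lemma dotv_restr S x : supp x \subset S -> dotv (restr S x) (restr S x) = dotv x x.
Proof.
move=> sx; rewrite !dotvE (sum_supp (fun i => x 0 i) sx) [RHS]big_enum_val.
by apply: eq_bigr => i _; rewrite !mxE.
Qed.

Lemma Hhat_quad S p x : supp x \subset S ->
  dotv (restr S x *m Hhat A S p) (restr S x) = qform A p x.
Proof.
move=> sx; rewrite /qform.
under [RHS]eq_bigr => i _ do under eq_bigr => j _ do rewrite -mulrA.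
under [RHS]eq_bigr => i _ do rewrite -mulr_sumr (sum_supp (fun j => cross A p i j ^+ 2) sx) big_enum_val.
rewrite (sum_supp _ sx) [RHS]big_enum_val dotvE.
under eq_bigr => j _ do rewrite mxE mulr_suml.
rewrite exchange_big /=; apply: eq_bigr => i _; rewrite mulr_sumr.
by apply: eq_bigr => j _; rewrite HhatE /restr !mxE; ring.
Qed.

Lemma qform_le_L_star ps x : supp x \subset Sstar A ps ->
  qform A ps x <= L_star A ps * dotv x x.
Proof.
move=> sx; rewrite -(Hhat_quad _ sx) -(dotv_restr sx).
exact/rayleigh_le_lambda_max/Hhat_sym.
Qed.

End HhatTheory.

(** * Nondegenerate instances *)

Section ExtendedExtrema.
Variables (R : realType) (n d : nat) (A : 'M[R]_(n, d)).
Implicit Types p : 'rV[R]_n.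
Local Open Scope ereal_scope.

Lemma bigmine_attained (P : pred 'I_n) (F : 'I_n -> R) i0 : P i0 ->
  exists2 i, P i & \big[mine/+oo]_(i | P i) (F i)%:E = (F i)%:E.
Proof.
move=> Pi0.
have [i1 Pi1 ->] := @eq_bigmin _ _ _ +oo%E i0 P (fun i => (F i)%:E) Pi0 (fun _ _ => leey _).
by exists i1.
Qed.

Lemma maxlev_le p (b : R) : (maxlev A p <= b%:E) <-> (forall i, (lev A p i <= b)%R).
Proof.
split=> [/bigmax_leP[_ h] i|h]; first by have := h i isT; rewrite lee_fin.
by apply/bigmax_leP; split=> [|i _]; rewrite ?leNye ?lee_fin.
Qed.

Lemma maxgap_le p (c : R) :
  (maxgap A p <= c%:E) <-> (forall i, (lev A p i <= d%:R + c)%R).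
Proof.
rewrite /maxgap leeBlDr // -EFinD (maxlev_le p).
by split=> h i; have := h i; rewrite addrC.
Qed.

Lemma minlev_supp_ge p (b : R) :
  (b%:E <= minlev_supp A p) <-> (forall i, (0 < p 0%R i)%R -> (b <= lev A p i)%R).
Proof.
split=> [/bigmin_geP[_ h] i pi|h]; first by have := h i pi; rewrite lee_fin.
by apply/bigmin_geP; split=> [|i pi]; rewrite ?leey ?lee_fin ?h.
Qed.

End ExtendedExtrema.

Section Instance.
Variables (R : realType) (n d : nat) (A : 'M[R]_(n, d)) (ps : 'rV[R]_n).
Hypothesis opt : optimal_design A ps.
Hypothesis nondeg : nondegenerate_design A ps.
Hypothesis zs_neq0 : zero_sum (R:=R) (Sstar A ps) <> [set 0].

Let S := Sstar A ps.
Let mu := mu_star A ps.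
Let L := L_star A ps.

Lemma opt_posdef : posdef (infoM A ps).
Proof. by case: opt. Qed.

Lemma opt_simplex : simplex ps.
Proof. by case: opt. Qed.

Lemma opt_supp : supp ps \subset S.
Proof. by case: nondeg => ->. Qed.

Lemma opt_face : face S ps.
Proof. by split; [exact: opt_simplex | exact: opt_supp]. Qed.

Lemma lev_Sstar i : i \in S -> lev A ps i = d%:R.
Proof. by rewrite inE => /eqP. Qed.

Lemma lev_opt_lt i : i \notin S -> lev A ps i < d%:R.
Proof.
move=> iS; case: nondeg => _ /bigmin_gtP[_ h] _.
by have := h i iS; rewrite lte_fin subr_gt0.
Qed.

Lemma lev_opt_le i : lev A ps i <= d%:R.
Proof.
by have [/lev_Sstar ->|/lev_opt_lt/ltW] := boolP (i \in S).
Qed.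

Lemma opt_gt0 i : i \in S -> 0 < ps 0 i.
Proof.
case: nondeg opt_simplex => /setP/(_ i) e _ _ [ge0 _].
by rewrite -e inE lt_neqAle ge0 andbT eq_sym.
Qed.

(** Condition (ii) of nondegeneracy is a free family indexed by positions in [enum S]; the proof
    moves the sum from indices to positions. *)
Lemma infoM_free x : supp x \subset S -> infoM A x = 0 -> x = 0.
Proof.
move=> sx x0; apply/rowP => i; rewrite mxE.
have [iS|iS] := boolP (i \in S); last exact: supp_out sx iS.
case: nondeg => _ _; set X := map _ _ => frX.
pose k (j : 'I_(size X)) := x 0 (nth i (enum S) j).
have := @freeP _ _ _ (in_tuple X); rewrite /= => /(_ frX k).
have sizeX : size X = size (enum S) by rewrite size_map.
have iX : (index i (enum S) < size X)%N by rewrite sizeX index_mem mem_enum.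
move=> h; have := h _ (Ordinal iX); rewrite /k /= nth_index ?mem_enum //; apply.
rewrite -[RHS]x0 /infoM.
transitivity (\sum_(j < size (enum S)) x 0 (nth i (enum S) j) *:
   ((row (nth i (enum S) j) A)^T *m row (nth i (enum S) j) A)).
  rewrite -(big_mkord xpredT (fun j => x 0 (nth i (enum S) j) *:
   ((row (nth i (enum S) j) A)^T *m row (nth i (enum S) j) A))) -sizeX big_mkord.
  by apply: eq_bigr => j _; rewrite /X (nth_map i) // -sizeX.
rewrite -(big_mkord xpredT (fun j => x 0 (nth i (enum S) j) *:
   ((row (nth i (enum S) j) A)^T *m row (nth i (enum S) j) A))).
rewrite -(big_nth i xpredT (fun j => x 0 j *: ((row j A)^T *m row j A))) big_enum.
rewrite [RHS](bigID (mem S)) /= [X in _ + X]big1 ?addr0 // => j jS.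
by rewrite (supp_out sx) // scale0r.
Qed.

Lemma qform_gt0 x : supp x \subset S -> x != 0 -> 0 < qform A ps x.
Proof.
move=> sx x0; rewrite lt_neqAle qform_ge0 ?andbT; last exact: opt_posdef.
rewrite eq_sym; apply: contra_neq x0 => e; apply: infoM_free => //.
exact: qform_eq0 opt_posdef e.
Qed.

Lemma mu_star_attained : exists x, [/\ zero_sum S x, x != 0 &
  qform A ps x = mu * dotv x x].
Proof.
have [[x [Tx x0 e]] _] := lambda_min_on_attained (Hhat_sym A S ps) zs_neq0.
by exists x; split=> //; rewrite -e Hhat_quad //; case: Tx.
Qed.

Lemma mu_star_le x : zero_sum S x -> mu * dotv x x <= qform A ps x.
Proof.
move=> Tx; have [_ /(_ x Tx)] := lambda_min_on_attained (Hhat_sym A S ps) zs_neq0.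
by rewrite Hhat_quad //; case: Tx.
Qed.

Lemma mu_star_gt0 : 0 < mu.
Proof.
have [x [[sx _] x0 e]] := mu_star_attained.
by have := qform_gt0 sx x0; rewrite e pmulr_lgt0 // dotv_gt0.
Qed.

Lemma mu_star_le_L : mu <= L.
Proof.
have [x [[sx _] x0 e]] := mu_star_attained.
by have := qform_le_L_star sx; rewrite e ler_pM2r // dotv_gt0.
Qed.

Lemma L_star_gt0 : 0 < L.
Proof. exact: lt_le_trans mu_star_gt0 mu_star_le_L. Qed.

Lemma kappa_ge1 : 1 <= kappa A ps.
Proof. by rewrite ler_pdivlMr ?mul1r; [exact: mu_star_le_L | exact: mu_star_gt0]. Qed.

(** If d <= 1, a frame has at most one coordinate. Leverage scores are constant on S, so a zero-sum
    x has trace 0 and hence M(x) = 0; independence then makes [zero_sum S] trivial. The factor d - 1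
    in the line-search gain needs this. *)
Lemma dim_ge2 : (2 <= d)%N.
Proof.
rewrite leqNgt; apply/negP => d2; have [x [[sx x1] x0 _]] := mu_star_attained.
case/eqP: x0; apply: infoM_free => //.
have [B [l [h _ _ [_ _ _ h0]]]] := frame_exists ps opt_posdef.
have one (j k : 'I_d) : j = k.
  apply: val_inj => /=; have := ltn_ord j; have := ltn_ord k.
  by case: (d) d2 j k => [|[|]] // _ [[|?] ?] [[|?] ?].
apply: h0 => k k'; rewrite -(one k k').
have := sum_lev_gram x h; rewrite [RHS](bigD1 k) //= [X in _ = _ + X]big1 ?addr0 => [<-|j]; last first.
  by rewrite (one j k) eqxx.
rewrite (sum_supp _ sx); under eq_bigr => i iS do rewrite (lev_Sstar iS).
by rewrite -mulr_suml -(sum_supp1 sx) x1 mul0r.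
Qed.

Lemma Sstar_neq0 : exists i, i \in S.
Proof.
case: (set_0Vmem S) => [S0|[i iS]]; last by exists i.
have [_ s1] := opt_simplex; have := oner_neq0 R.
rewrite -s1 (sum_supp1 opt_supp) S0 big_set0 eqxx //.
Qed.

Lemma dim_ge2R : 2 <= d%:R :> R.
Proof. by rewrite ler_nat dim_ge2. Qed.

Lemma gamma_sc_cases :
  (gamma_sc A ps = +oo%E /\ forall i, i \in S) \/
  exists2 g : R, gamma_sc A ps = g%:E &
    0 < g /\ (forall i, i \notin S -> g <= d%:R - lev A ps i).
Proof.
have [h|h] := pselect (forall i, i \in S).
  by left; split=> //; rewrite /gamma_sc big_pred0 // => i; rewrite h.
right; have [i0 i0S] : exists i, i \notin S.
  by apply: contrapT => h'; apply: h => i; apply: contrapT => /negP iS; apply: h'; exists i.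
have [i1 i1S e] := bigmine_attained (P := fun i => i \notin S) (fun i => d%:R - lev A ps i) i0S.
exists (d%:R - lev A ps i1) => //; split; first by rewrite subr_gt0 lev_opt_lt.
move=> i iS; rewrite -lee_fin -e; exact: bigmin_le_cond.
Qed.

(** The bound 1/2 serves quadratic growth, the second bound separates the leverage scores off S from
    d, and the third keeps weights on S positive. The second stays in extended reals since
    [gamma_sc] may be infinite. *)
Lemma rbarP : [/\ 0 < rbar A ps <= 2^-1,
  (((rbar A ps)%:E <= gamma_sc A ps * ((2 * d%:R)^-1)%:E)%E) &
  forall i, i \in S -> rbar A ps <= ps 0 i * (Num.sqrt mu / 2)].
Proof.
rewrite /rbar; set b := (gamma_sc A ps * _)%E; set c := (pmin A ps * _)%E.
set X := mine _ _.
have sm : 0 < Num.sqrt mu / 2 by rewrite divr_gt0 // sqrtr_gt0 mu_star_gt0.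
have [i0 i0S] := Sstar_neq0.
have [i1 i1S pE] := bigmine_attained (P := fun i => i \in S) (ps 0) i0S.
have cE : c = (ps 0 i1 * (Num.sqrt mu / 2))%:E by rewrite /c /pmin pE.
have b0 : (0 < b)%E.
  apply: mule_gt0; first by case: nondeg.
  by rewrite lte_fin invr_gt0; have := dim_ge2R; lra.
have X0 : (0 < X)%E.
  rewrite !lt_min b0 cE !lte_fin; apply/andP; split; first by lra.
  by rewrite mulr_gt0 // opt_gt0.
have Xle : (X <= (2^-1)%:E)%E by rewrite ge_min lexx.
have XE : X = (fine X)%:E by case: (X) X0 Xle.
split.
- by rewrite -!lte_fin -lee_fin -XE X0.
- by rewrite -XE !ge_min lexx orbT.
- move=> i iS; rewrite -lee_fin -XE (@le_trans _ _ c) //.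
    by rewrite !ge_min lexx !orbT.
  rewrite cE lee_fin ler_pM2r // -lee_fin -pE; exact: bigmin_le_cond.
Qed.

Lemma rbar_out i : i \notin S -> 2 * d%:R * rbar A ps <= d%:R - lev A ps i.
Proof.
move=> iS; have [_ h _] := rbarP.
have [[_ all]|[g gE [g0 gle]]] := gamma_sc_cases; first by rewrite all in iS.
have d0 : 0 < 2 * d%:R :> R by have := dim_ge2R; lra.
apply: le_trans (gle i iS); move: h; rewrite gE -EFinM lee_fin.
by rewrite ler_pdivlMr // mulrC.
Qed.

Lemma c_0_gt0 : 0 < c_0 A ps.
Proof. by apply: zeta_gt0; have [/andP[]] := rbarP. Qed.

End Instance.

(** * The facial phase *)

Section FacialPhase.
Variables (R : realType) (n d : nat) (A : 'M[R]_(n, d)) (ps : 'rV[R]_n).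
Hypothesis opt : optimal_design A ps.
Hypothesis nondeg : nondegenerate_design A ps.
Hypothesis zs_neq0 : zero_sum (R:=R) (Sstar A ps) <> [set 0].

Let S := Sstar A ps.
Let mu := mu_star A ps.
Let L := L_star A ps.
Let pps : posdef (infoM A ps) := opt_posdef opt.
Let mu0 : 0 < mu := mu_star_gt0 opt nondeg zs_neq0.
Let L0 : 0 < L := L_star_gt0 opt nondeg zs_neq0.

Implicit Types x y z g : 'rV[R]_n.

Definition excess x : R := fdes A x - fdes A ps.

Lemma sub_opt_supp x : supp x \subset S -> supp (x - ps) \subset S.
Proof.
by move=> sx; apply: suppP => i iS; rewrite row_subE !(supp_out _ iS) ?subrr ?(opt_supp nondeg).
Qed.

(** The linear term is the complementary slackness at [ps]: nonnegative on designs and zero on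
    vectors supported on S. No sign condition on x is imposed. *)
Lemma excess_bregman x : \sum_i x 0 i = 1 ->
  excess x = bregman A ps x + \sum_i x 0 i * (d%:R - lev A ps i).
Proof.
move=> x1; rewrite /bregman -/(excess x) -addrA -big_split /=.
suff -> : \sum_i ((x 0 i - ps 0 i) * lev A ps i + x 0 i * (d%:R - lev A ps i)) = 0.
  by rewrite addr0.
under eq_bigr => i _ do rewrite mulrBr mulrBl addrC addrA subrK.
by rewrite sumrB (sum_lev pps) -mulr_suml x1 mul1r subrr.
Qed.

Lemma excess_face x : supp x \subset S -> \sum_i x 0 i = 1 ->
  excess x = bregman A ps x.
Proof.
move=> sx /excess_bregman ->; rewrite (sum_supp _ sx) big1 ?addr0 // => i iS.
by rewrite (lev_Sstar iS) subrr mulr0.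
Qed.

Lemma bregman_le_excess x : simplex x -> bregman A ps x <= excess x.
Proof.
move=> [x0 /excess_bregman ->]; rewrite lerDl; apply: sumr_ge0 => i _.
by rewrite mulr_ge0 // subr_ge0 (lev_opt_le nondeg).
Qed.

Lemma excess_ge0 x : simplex x -> posdef (infoM A x) -> 0 <= excess x.
Proof. by move=> sx px; apply: le_trans (bregman_le_excess sx); exact: bregman_ge0. Qed.

Lemma quadratic_growth x : face S x -> posdef (infoM A x) ->
  excess x <= c_0 A ps ->
  2 / 9 * mu * dotv (x - ps) (x - ps) <= excess x.
Proof.
move=> [[x0 x1] sx] px; have [/andP[r0 r1] _ _] := rbarP opt nondeg zs_neq0.
have r01 : 0 <= rbar A ps <= 1 / 2 by lra.
rewrite excess_face // => /(qform_le_bregman pps px r01); apply: le_trans.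
have two9 : 0 <= 2 / 9 :> R by lra.
rewrite -mulrA (ler_wpM2l two9) //.
apply: mu_star_le => //; apply: zero_sumB => //; first exact: opt_supp.
by case: (opt_simplex opt) => _ ->.
Qed.

(** The radius is chosen to give local distance 1/4, the range in which [qform] changes by at most a
    factor 2. Entries of x may be negative. *)
Lemma posdef_ball x : supp x \subset S -> 16 * L * dotv (x - ps) (x - ps) <= 1 ->
  qform A ps (x - ps) <= 1 / 16 /\ posdef (infoM A x).
Proof.
move=> sx h; have q : qform A ps (x - ps) <= 1 / 16.
  by have := qform_le_L_star (sub_opt_supp sx); rewrite -/L; lra.
split=> //; apply: (@posdef_near _ _ _ _ ps x (1 / 4) pps); first by lra.
by apply: le_trans q _; lra.
Qed.

Lemma grad_h_dotv y z : zero_sum S z ->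
  dotv (grad_h A S y) z = - \sum_i z 0 i * lev A y i.
Proof.
move=> Tz; rewrite /grad_h eproj_zero_sum dotv_zproj // dotvE -sumrN.
case: Tz => sz _; apply: eq_bigr => i _; rewrite mxE; case: ifPn => iS; first by ring.
by rewrite (supp_out sz iS) !mulr0 mul0r oppr0.
Qed.

Lemma grad_h_zero_sum y : zero_sum S (grad_h A S y).
Proof. by rewrite /grad_h eproj_zero_sum; exact: zproj_zero_sum. Qed.

(** The facial gradient vanishes at [ps], as leverage scores are constant on S. Testing the
    Lipschitz bound with z = g gives |g|^4 <= 4 L |g|^2 L |y - ps|^2, and one divides by |g|^2. *)
Lemma grad_h_le y : supp y \subset S -> 16 * L * dotv (y - ps) (y - ps) <= 1 ->
  dotv (grad_h A S y) (grad_h A S y) <= 4 * L ^+ 2 * dotv (y - ps) (y - ps).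
Proof.
move=> sy h; set g := grad_h A S y; have [q _] := posdef_ball sy h.
have Tg : zero_sum S g := grad_h_zero_sum y; have [sg g0] := Tg.
have q4 : qform A ps (y - ps) <= 1 / 4 by lra.
have := lev_lipschitz g pps q4.
have -> : \sum_i g 0 i * (lev A y i - lev A ps i) = - dotv g g.
  rewrite {2}/g grad_h_dotv // opprK.
  under eq_bigr => i _ do rewrite mulrBr; rewrite sumrB.
  rewrite (sum_supp (lev A ps) sg).
  under [X in _ - X]eq_bigr => i iS do rewrite (lev_Sstar iS).
  by rewrite -mulr_suml -(sum_supp1 sg) g0 mul0r subr0.
have h1 := qform_le_L_star sg; have h2 := qform_le_L_star (sub_opt_supp sy).
have q1 := qform_ge0 g pps; have q2 := qform_ge0 (y - ps) pps.
have g2 := dotv_ge0 g; have y2 := dotv_ge0 (y - ps).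
rewrite -/L in h1 h2; rewrite sqrrN.
have [-> _|gn0] := eqVneq (dotv g g) 0.
  by rewrite mulr_ge0 // mulr_ge0 // sqr_ge0.
have gp : 0 < dotv g g by rewrite lt_neqAle eq_sym gn0.
move=> h3; rewrite -(ler_pM2l gp) -expr2; apply: le_trans h3 _.
have : qform A ps g * qform A ps (y - ps) <= (L * dotv g g) * (L * dotv (y - ps) (y - ps)).
  by apply: ler_pM.
by move=> ?; lra.
Qed.

Lemma sqr_dotvD x y : dotv (x + y) (x + y) <= 2 * dotv x x + 2 * dotv y y.
Proof.
have := dotv_ge0 (x - y).
rewrite !(dotvDl, dotvDr, dotvNl, dotvNr) (dotvC y x); lra.
Qed.

(** Here a = y - ps, c is the scaled gradient and e = x' - ps. The projection inequality tested at
    [ps] gives |e| <= |a - c|, and |a - c|^2 <= 2 |a|^2 + 2 |c|^2. *)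
Lemma prox_dist (a c e : 'rV[R]_n) : dotv (a - c - e) (- e) <= 0 ->
  dotv c c <= dotv a a / 4 -> dotv e e <= 5 / 2 * dotv a a.
Proof.
have := sqr_dotvD a (- c); have := dotv_ge0 (a - c - e).
rewrite !(dotvDl, dotvDr, dotvNl, dotvNr) (dotvC c a) (dotvC e a) (dotvC e c); lra.
Qed.

(** The proximal-gradient inequality, from descent and convexity at y and the projection inequality.
    The constant 100 is a safe radius: |x' - y|^2 <= 7 |y - ps|^2 gives 2 L |x' - y|^2 <= 14/100,
    within the bound 1/4 under which the divergence is at most [qform]. *)
Lemma prox_step y (x' := eproj (face S) (y - (4 * L)^-1 *: grad_h A S y)) :
  supp y \subset S -> \sum_i y 0 i = 1 ->
  100 * L * dotv (y - ps) (y - ps) <= 1 ->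
  [/\ face S x', posdef (infoM A x') & forall z, face S z -> posdef (infoM A z) ->
    excess x' - excess z <=
    2 * L * (2 * dotv (y - x') (x' - z) + dotv (x' - y) (x' - y))].
Proof.
move=> sy y1 h; set g := grad_h A S y in x' *.
have a0 := dotv_ge0 (y - ps).
have h16 : 16 * L * dotv (y - ps) (y - ps) <= 1.
  by have := mulr_ge0 (ltW L0) a0; lra.
have [qy py] := posdef_ball sy h16.
have [i0 i0S] := Sstar_neq0 opt nondeg.
have [Fx' varx'] := eproj_face (y - (4 * L)^-1 *: g) i0S.
rewrite -/x' in Fx' varx'.
have [[x'0 x'1] sx'] := Fx'.
have Tg : zero_sum S g := grad_h_zero_sum y.
have L4p : 0 < 4 * L by rewrite mulr_gt0.
have L4 : 4 * L != 0 by rewrite gt_eqF.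
pose gm := (4 * L)^-1 *: g.
have gm_le : dotv gm gm <= dotv (y - ps) (y - ps) / 4.
  have := grad_h_le sy h16; rewrite -/g => hg.
  rewrite /gm dotvZl dotvZr mulrA -expr2 exprVn ler_pdivrMl ?exprn_gt0 //.
  by lra.
have dist : dotv (x' - ps) (x' - ps) <= 5 / 2 * dotv (y - ps) (y - ps).
  apply: (@prox_dist _ gm); last exact: gm_le.
  have := varx' ps (opt_face opt nondeg).
  congr (dotv _ _ <= 0); last by rewrite opprB.
  by apply/rowP => i; rewrite !row_subE /gm; ring.
have dxy : dotv (x' - y) (x' - y) <= 7 * dotv (y - ps) (y - ps).
  have -> : x' - y = (x' - ps) + - (y - ps) by apply/rowP => i; rewrite !mxE; ring.
  by have := sqr_dotvD (x' - ps) (- (y - ps)); rewrite dotvNl dotvNr opprK; lra.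
have LD := mulr_ge0 (ltW L0) a0.
have px' : posdef (infoM A x').
  have : 16 * L * dotv (x' - ps) (x' - ps) <= 1.
    by have := ler_wpM2l (ltW L0) dist; lra.
  by move=> /(posdef_ball sx')[].
have Tdiff z w : face S z -> supp w \subset S -> \sum_i w 0 i = 1 -> zero_sum S (z - w).
  by move=> [[_ z1] sz] sw w1; apply: zero_sumB => //; rewrite z1 w1.
have [sxy _] := Tdiff x' y Fx' sy y1.
have q2 : qform A y (x' - y) <= 2 * L * dotv (x' - y) (x' - y).
  apply: le_trans (qform_near _ pps qy) _; rewrite -mulrA ler_wpM2l //.
  exact: qform_le_L_star.
have desc : bregman A y x' <= 2 * L * dotv (x' - y) (x' - y).
  apply: le_trans (q2); apply: bregman_le_qform => //; apply: le_trans q2 _.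
  by have := ler_wpM2l (ltW L0) dxy; lra.
split=> // z Fz pz.
(* Convexity of f between y and z, in the form of a nonnegative divergence; it holds even if y has
   negative entries. *)
have conv := bregman_ge0 py pz.
have bE w : face S w -> bregman A y w = excess w - excess y - dotv g (w - y).
  move=> Fw; rewrite grad_h_dotv; last exact: Tdiff.
  rewrite opprK /bregman /excess; congr (_ + _); first by ring.
  by apply: eq_bigr => i _; rewrite row_subE.
move: desc conv; rewrite !bE // => desc conv.
have := ler_wpM2l (ltW L0) (varx' z Fz); rewrite mulr0.
have -> : y - (4 * L)^-1 *: g - x' = (y - x') - (4 * L)^-1 *: g.
  by rewrite addrAC.
rewrite (dotvBl (y - x')) dotvZl mulrBr mulrA.
have -> : L * (4 * L)^-1 = 1 / 4 by field; move: L4; rewrite mulf_eq0 negb_or => /andP[].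
have -> : dotv g (z - x') = dotv g (z - y) - dotv g (x' - y).
  by rewrite -dotvBr; congr dotv; apply/rowP => i; rewrite !mxE; ring.
have -> : dotv (y - x') (x' - z) = - dotv (y - x') (z - x') by rewrite -dotvNr opprB.
lra.
Qed.

End FacialPhase.

(** * One FISTA cycle confined to a ball around the optimum *)

Section RestartedFista.
Variables (R : realType) (n d : nat) (A : 'M[R]_(n, d)) (ps : 'rV[R]_n).
Hypothesis opt : optimal_design A ps.
Hypothesis nondeg : nondegenerate_design A ps.
Hypothesis zs_neq0 : zero_sum (R:=R) (Sstar A ps) <> [set 0].

Let S := Sstar A ps.
Let L := L_star A ps.
Let pps : posdef (infoM A ps) := opt_posdef opt.
Let L0 : 0 < L := L_star_gt0 opt nondeg zs_neq0.

Implicit Types x y z g : 'rV[R]_n.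

Lemma dotv_convex (a : R) x y (D : R) : 0 <= a <= 1 ->
  dotv x x <= D -> dotv y y <= D ->
  dotv ((1 - a) *: x + a *: y) ((1 - a) *: x + a *: y) <= D.
Proof.
move=> /andP[a0 a1] hx hy.
have h : 0 <= a * (1 - a) * dotv (x - y) (x - y).
  by rewrite mulr_ge0 ?dotv_ge0 // mulr_ge0 // subr_ge0.
have h1 : 0 <= a * (D - dotv y y) by rewrite mulr_ge0 // subr_ge0.
have h2 : 0 <= (1 - a) * (D - dotv x x) by rewrite mulr_ge0 // subr_ge0.
move: h; rewrite !(dotvDl, dotvDr, dotvNl, dotvNr, dotvZl, dotvZr) (dotvC y x); lra.
Qed.

Lemma fista_nextP (t : R) : 1 <= t ->
  fista_next t ^+ 2 - fista_next t = t ^+ 2 /\ t + 2^-1 <= fista_next t.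
Proof.
move=> t1; rewrite /fista_next; set s := Num.sqrt _.
have h0 : 0 <= 1 + 4 * t ^+ 2 by have := sqr_ge0 t; lra.
have ss : s ^+ 2 = 1 + 4 * t ^+ 2 by rewrite sqr_sqrtr.
have s0 : 0 <= s by exact: sqrtr_ge0.
split; first by lra.
have : 2 * t <= s; last by lra.
rewrite -ler_sqr ?nnegrE ?ss //; last by lra.
lra.
Qed.

(** The stored t is t_(k+1), so t^2 - t is t_k^2, the usual FISTA weight; at k = 0 it is 0, hence
    the guard on its lower bound. The point y is constrained only to the affine hull of the face and
    to the ball. *)
Definition fista_invariant (D : R) (k : nat) (s : 'rV[R]_n * 'rV[R]_n * R) : Prop :=
  let: (x, y, t) := s in
  let u := x + t *: (y - x) in
  [/\ face S x, posdef (infoM A x),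
      [/\ supp y \subset S, \sum_i y 0 i = 1 & dotv (y - ps) (y - ps) <= D],
      [/\ 1 <= t, k.+2%:R / 2 <= t &
          (0 < k)%N -> (k.+1%:R / 2) ^+ 2 <= t ^+ 2 - t] &
      (t ^+ 2 - t) * excess A ps x + 2 * L * dotv (u - ps) (u - ps) <= 2 * L * D
      /\ dotv (x - ps) (x - ps) <= D].

Lemma fistaP D x0 k : face S x0 -> posdef (infoM A x0) ->
  dotv (x0 - ps) (x0 - ps) <= D -> 100 * L * D <= 1 ->
  fista_invariant D k (fista A S (4 * L) x0 k).
Proof.
move=> Fx0 px0 hD D1; elim: k => [|k] /=.
  have [[_ x01] sx0] := Fx0.
  do ![split=> //]; first by rewrite divff // pnatr_eq0.
  rewrite subrr scaler0 addr0 expr1n subrr mul0r add0r ler_pM2l // mulr_gt0 //.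
case: (fista A S (4 * L) x0 k) => [[x y] t].
case=> Fx px [sy y1 yD] [t1 tk _] [lyap xD].
have yD' : 100 * L * dotv (y - ps) (y - ps) <= 1.
  apply: le_trans D1; rewrite ler_wpM2l // mulr_ge0 //; exact: ltW.
have [] := prox_step opt nondeg zs_neq0 sy y1 yD'.
set x' := eproj _ _; set t' := fista_next t => Fx' px' key.
have [t'E t'ge] := fista_nextP t1; rewrite -/t' in t'E t'ge.
have tp : 0 < t by lra.
have t'p : 0 < t' by lra.
set y' := x' + _ *: _.
pose u := x + t *: (y - x); rewrite -/u in lyap.
pose u' := x' + (t - 1) *: (x' - x).
have u'E : x' + t' *: (y' - x') = u'.
  by rewrite /y' addrAC subrr add0r scalerA /u' mulrC divfK // gt_eqF.
have [[x'0 x'1] sx'] := Fx'; have [[x_0 x_1] sx] := Fx.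
have ex' : 0 <= excess A ps x' by apply: (excess_ge0 opt nondeg).
have lyap' : t ^+ 2 * excess A ps x' + 2 * L * dotv (u' - ps) (u' - ps) <= 2 * L * D.
  apply: le_trans lyap.
  (* Weights t (t - 1) at x and t at [ps] add up to t^2, and the quadratic terms then telescope into
     |u' - ps|^2 - |u - ps|^2. *)
  have k1 := key x Fx px; have k2 := key ps (opt_face opt nondeg) pps.
  rewrite /excess subrr subr0 in k2; rewrite -/(excess A ps x') in k2.
  have tt : 0 <= t * (t - 1) by rewrite mulr_ge0; lra.
  have := ler_wpM2l tt k1; have := ler_wpM2l (ltW tp) k2.
  rewrite /u' /u -/L !(dotvDl, dotvDr, dotvNl, dotvNr, dotvZl, dotvZr).
  rewrite (dotvC x' y) (dotvC x y) (dotvC ps y) (dotvC x x') (dotvC ps x') (dotvC ps x).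
  by lra.
have L2 : 0 < 2 * L by rewrite mulr_gt0.
have u'D : dotv (u' - ps) (u' - ps) <= D.
  rewrite -(ler_pM2l L2); apply: le_trans lyap'; rewrite lerDr mulr_ge0 // sqr_ge0 //.
have x'D : dotv (x' - ps) (x' - ps) <= D.
  have -> : x' - ps = (1 - t^-1) *: (x - ps) + t^-1 *: (u' - ps).
    by apply/rowP => i; rewrite /u' !mxE; field; rewrite gt_eqF.
  by apply: dotv_convex => //; rewrite invr_ge0 ltW //= invf_le1.
have y'D : dotv (y' - ps) (y' - ps) <= D.
  have -> : y' - ps = (1 - t'^-1) *: (x' - ps) + t'^-1 *: (u' - ps).
    by apply/rowP => i; rewrite /y' /u' !mxE; field; rewrite gt_eqF.
  by apply: dotv_convex => //; rewrite invr_ge0 ltW //= invf_le1; lra.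
split=> //.
- split=> //.
    apply: suppP => i iS; rewrite /y' row_addE row_scaleE row_subE.
    by rewrite (supp_out sx' iS) (supp_out sx iS); ring.
  rewrite /y'; under eq_bigr => i _ do rewrite row_addE row_scaleE row_subE.
  by rewrite big_split /= -mulr_sumr sumrB x'1 x_1 subrr mulr0 addr0.
- split; [by lra | by rewrite -[k.+3]addn1 natrD; lra | move=> _; rewrite t'E].
  by rewrite ler_sqr ?nnegrE //; lra.
- by rewrite u'E t'E.
Qed.

End RestartedFista.

(** * Contraction over one cycle and properties of its end point *)

Section FacialReturn.
Variables (R : realType) (n d : nat) (A : 'M[R]_(n, d)) (ps : 'rV[R]_n).
Hypothesis opt : optimal_design A ps.
Hypothesis nondeg : nondegenerate_design A ps.
Hypothesis zs_neq0 : zero_sum (R:=R) (Sstar A ps) <> [set 0].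

Let S := Sstar A ps.
Let mu := mu_star A ps.
Let L := L_star A ps.
Let pps : posdef (infoM A ps) := opt_posdef opt.

Implicit Types x y z g : 'rV[R]_n.

(** The invariant shared by the exit point of the loop and by every cycle end, so that each cycle
    can be analysed afresh. *)
Definition warm x : Prop :=
  [/\ face S x, posdef (infoM A x) & excess A ps x <= tol A ps].

Lemma warm_excess_ge0 x : warm x -> 0 <= excess A ps x.
Proof. by move=> [[Fx _] px _]; exact: (excess_ge0 opt nondeg). Qed.

Lemma warm_growth x : warm x -> 2 / 9 * mu * dotv (x - ps) (x - ps) <= excess A ps x.
Proof.
move=> [Fx px ex]; apply: quadratic_growth => //; apply: le_trans ex _.
by rewrite ge_min lexx.
Qed.

(* Since tol <= c_1 / kappa^3 and kappa >= 1, L |x - ps|^2 <= (9 / 2) c_1. *)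
Lemma warm_dist x : warm x -> 100 * L * dotv (x - ps) (x - ps) <= 1.
Proof.
move=> wx; have := warm_growth wx; case: wx => _ _.
rewrite le_min => /andP[_].
have mu0 : 0 < mu := mu_star_gt0 opt nondeg zs_neq0.
have k1 : 1 <= kappa A ps := kappa_ge1 opt nondeg zs_neq0.
have -> : L = kappa A ps * mu by rewrite /kappa divfK // gt_eqF.
set k := kappa A ps in k1 *; set D := dotv _ _.
have k3 : 0 < k ^+ 3 by apply: exprn_gt0; lra.
rewrite ler_pdivlMr // => h1 h2; have D0 : 0 <= D := dotv_ge0 _.
have h3 : 2 / 9 * mu * D * k ^+ 3 <= c_1 R.
  by apply: le_trans h1; rewrite ler_wpM2r // ltW.
have kk : k <= k ^+ 3.
  have h : 0 <= k * (k - 1) * (k + 1) by apply: mulr_ge0; [apply: mulr_ge0|]; lra.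
  by lra.
have muD : 0 <= mu * D by rewrite mulr_ge0 // ltW.
have := ler_wpM2l muD kk; rewrite /c_1 in h3; lra.
Qed.

Lemma kappa_locE : kappa_loc A ps = 9 * kappa A ps.
Proof.
have := mu_star_gt0 opt nondeg zs_neq0; rewrite /kappa_loc /kappa /L_loc /mu_loc => m0.
by field; rewrite gt_eqF.
Qed.

Let N := cycle_len (kappa_loc A ps).

(** N + 1 is the rounded-up square root of 8 kappa_loc = 72 kappa. That root exceeds 8 and is at
    most 9 sqrt kappa; rounding adds at most 1 <= sqrt kappa, hence 10. *)
Lemma cycle_lenP : [/\ (0 < N)%N, 72 * kappa A ps <= N.+1%:R ^+ 2 &
  N.+1%:R <= 10 * Num.sqrt (kappa A ps)].
Proof.
have k1 : 1 <= kappa A ps := kappa_ge1 opt nondeg zs_neq0.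
rewrite /N /cycle_len kappa_locE.
have -> : 8 * (9 * kappa A ps) = 72 * kappa A ps by ring.
set s := Num.sqrt (72 * _).
have ss : s ^+ 2 = 72 * kappa A ps by rewrite sqr_sqrtr //; lra.
have s0 : 0 <= s by exact: sqrtr_ge0.
set q := Num.sqrt (kappa A ps).
have qq : q ^+ 2 = kappa A ps by rewrite sqr_sqrtr //; lra.
have q0 : 0 <= q by exact: sqrtr_ge0.
have s8 : 8 < s by rewrite -ltr_sqr ?nnegrE // ss; lra.
have s9 : s <= 9 * q by rewrite -ler_sqr ?nnegrE ?mulr_ge0 // ss exprMn qq; lra.
have q1 : 1 <= q by rewrite -ler_sqr ?nnegrE // qq expr1n.
have /andP[] := real_ceil_itv (num_real s).
case: (Num.ceil s) => [m|m]; last first.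
  by rewrite NegzE intrN => _ h; have : 0 <= m.+1%:~R :> R by []; lra.
rewrite intrB -pmulrn => h1 h2.
have m1 : (1 < m)%N by rewrite -(ltr_nat R); lra.
rewrite absz_nat prednK ?(ltn_trans _ m1) //; split; first by rewrite -subn1 subn_gt0.
  by rewrite -ss ler_sqr ?nnegrE.
by lra.
Qed.

Let cyc := fista_cycle A S (L_loc A ps) (kappa_loc A ps).

(** The FISTA weight is at least (N + 1)^2 / 4 >= 18 kappa, while quadratic growth bounds 2 L |x -
    ps|^2 by 9 kappa times the excess at x. The ratio is 1/2. *)
Lemma warm_cycle x : warm x -> warm (cyc x) /\ excess A ps (cyc x) <= excess A ps x / 2.
Proof.
move=> wx; have hD := warm_dist wx; have hg := warm_growth wx.
have ex0 := warm_excess_ge0 wx; have [Fx px ex] := wx.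
have mu0 : 0 < mu := mu_star_gt0 opt nondeg zs_neq0.
have := fistaP opt nondeg zs_neq0 N Fx px (lexx _) hD.
rewrite /cyc /fista_cycle -/N /L_loc -/S -/L.
case: (fista A S (4 * L) x N) => [[x' y] t] /=.
have [N0 N72 _] := cycle_lenP.
case=> Fx' px' _ [t1 _ /(_ N0) tau] [lyap _].
have ex' : 0 <= excess A ps x' by case: (Fx') => sx' _; exact: (excess_ge0 opt nondeg).
have half : excess A ps x' <= excess A ps x / 2.
  have L0 : 0 < L := L_star_gt0 opt nondeg zs_neq0.
  have h1 : (t ^+ 2 - t) * excess A ps x' <= 2 * L * dotv (x - ps) (x - ps).
    apply: le_trans lyap; rewrite lerDl mulr_ge0 ?dotv_ge0 // mulr_ge0 // ltW //.
  have h2 : 18 * kappa A ps <= t ^+ 2 - t.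
    by apply: le_trans tau; rewrite expr_div_n; lra.
  have h3 : 18 * kappa A ps * excess A ps x' <= 2 * L * dotv (x - ps) (x - ps).
    by apply: le_trans h1; rewrite ler_wpM2r.
  have k0 : 0 < kappa A ps by have := kappa_ge1 opt nondeg zs_neq0; lra.
  rewrite -(ler_pM2l k0); have LE : L = kappa A ps * mu by rewrite /kappa divfK // gt_eqF.
  have := ler_wpM2l (ltW k0) hg; rewrite LE in h3; lra.
by split=> //; split=> //; lra.
Qed.

Lemma warm_queries x w : warm x ->
  w \in cycle_queries A S (L_loc A ps) (kappa_loc A ps) x ->
  supp w \subset S /\ posdef (infoM A w).
Proof.
move=> wx; rewrite /cycle_queries mem_rcons inE => /orP[/eqP ->|].
  by have [[[_ ?] ? _] _] := warm_cycle wx.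
case/mapP => k _ ->; have hD := warm_dist wx; have [Fx px ex] := wx.
have := fistaP opt nondeg zs_neq0 k Fx px (lexx _) hD.
rewrite /L_loc -/S -/L; case: (fista A S (4 * L) x k) => [[x' y] t] /=.
case=> _ _ [sy _ yD] _ _; split=> //.
have L0 : 0 < L := L_star_gt0 opt nondeg zs_neq0.
have [//|_ //] := posdef_ball opt nondeg (x := y) sy.
have := ler_wpM2l (ltW L0) yD; have := mulr_ge0 (ltW L0) (dotv_ge0 (y - ps)); rewrite -/L; lra.
Qed.

Lemma warm_lev_out x i : simplex x -> posdef (infoM A x) ->
  excess A ps x <= c_0 A ps -> i \notin S -> lev A x i <= d%:R.
Proof.
move=> sx px ex iS; have [/andP[r0 r1] _ _] := rbarP opt nondeg zs_neq0.
have r01 : 0 <= rbar A ps < 1 by lra.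
have hb := le_trans (bregman_le_excess opt nondeg sx) ex.
have [h _] := lev_le_bregman i pps px r01 hb; apply: le_trans h _.
have := rbar_out opt nondeg zs_neq0 iS; have := dim_ge2R opt nondeg zs_neq0.
rewrite ler_pdivrMr; last by lra.
move=> d2 h; have : 0 <= d%:R * rbar A ps by rewrite mulr_ge0 // ltW.
lra.
Qed.

(** On S, testing with a basis vector gives (v_i - d)^2 <= 4 L^2 |x - ps|^2, and growth replaces |x
    - ps|^2 by 9 / (2 mu) times the excess, whence 18. Off S the scores do not exceed d. *)
Lemma warm_gap x (e : R) : warm x -> 0 <= e ->
  18 * L ^+ 2 / mu * excess A ps x <= e ^+ 2 -> (maxgap A x <= e%:E)%E.
Proof.
move=> wx e0 h; apply/maxgap_le => i.
have hD := warm_dist wx; have hg := warm_growth wx; have [[sx sS] px ex] := wx.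
have [iS|iS] := boolP (i \in S); last first.
  have := @warm_lev_out x i sx px (le_trans ex _) iS.
  by rewrite ge_min lexx => /(_ isT); lra.
have mu0 : 0 < mu := mu_star_gt0 opt nondeg zs_neq0.
have L0 : 0 < L := L_star_gt0 opt nondeg zs_neq0.
have D0 := dotv_ge0 (x - ps).
have [q _] := posdef_ball opt nondeg (x := x) sS ltac:(have := mulr_ge0 (ltW L0) D0; rewrite -/L; lra).
have q4 : qform A ps (x - ps) <= 1 / 4 by lra.
have := lev_lipschitz (delta_mx 0 i) pps q4.
rewrite (bigD1 i) //= mxE !eqxx mul1r big1 ?addr0; last first.
  by move=> j ji; rewrite mxE (negbTE ji) andbF mul0r.
rewrite (lev_Sstar iS) => hl.
have sd : supp (delta_mx 0 i : 'rV[R]_n) \subset S.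
  by apply: suppP => j jS; rewrite mxE eqxx /=; case: eqP jS => // ->; rewrite iS.
have h1 := qform_le_L_star sd; have h2 := qform_le_L_star (sub_opt_supp nondeg sS).
rewrite dotv_delta mxE !eqxx mulr1 -/L in h1; rewrite -/L in h2.
have q1 := qform_ge0 (delta_mx 0 i) pps; have q2 := qform_ge0 (x - ps) pps.
have h3 := ler_pM q1 q2 h1 h2.
have h4 : (lev A x i - d%:R) ^+ 2 <= e ^+ 2.
  apply: le_trans h; apply: le_trans hl _; rewrite -mulrA.
  have -> : 18 * L ^+ 2 / mu * excess A ps x =
    4 * (9 / 2 * L ^+ 2 * (excess A ps x / mu)) by field; rewrite gt_eqF.
  rewrite ler_pM2l //; apply: le_trans h3 _.
  have : 2 / 9 * dotv (x - ps) (x - ps) <= excess A ps x / mu.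
    by rewrite ler_pdivlMr //; lra.
  by move=> h5; have := ler_wpM2l (sqr_ge0 L) h5; lra.
have [hle|hlt] := lerP (lev A x i) d%:R; first by lra.
have : lev A x i - d%:R <= e; last by lra.
by rewrite -ler_sqr ?nnegrE //; lra.
Qed.

(** For i in S, growth, zeta t <= t^2 / 2 and the third bound in [rbar] give (x_i - ps_i)^2 <=
    (9/16) ps_i^2, hence x_i > 0. The affine hull of the face fixes support and total weight, so
    only positivity can fail near x. *)
Lemma warm_relint x : warm x -> relint (face S) x.
Proof.
move=> wx; have hg := warm_growth wx; have [[[x0 x1] sS] px ex] := wx.
have mu0 : 0 < mu := mu_star_gt0 opt nondeg zs_neq0.
have [/andP[r0 r1] _ rp] := rbarP opt nondeg zs_neq0.
have xpos i : i \in S -> 0 < x 0 i.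
  move=> iS; have p0 := opt_gt0 opt nondeg iS.
  have h1 : (x 0 i - ps 0 i) ^+ 2 <= dotv (x - ps) (x - ps).
    rewrite dotvE (bigD1 i) //= row_subE -expr2 lerDl sumr_ge0 // => j _.
    by rewrite -expr2 sqr_ge0.
  have h2 : excess A ps x <= rbar A ps ^+ 2 / 2.
    apply: le_trans ex _; rewrite ge_min; apply/orP; left.
    exact/zeta_le_half_sqr/ltW.
  have h3 : rbar A ps ^+ 2 <= ps 0 i ^+ 2 * mu / 4.
    have -> : ps 0 i ^+ 2 * mu / 4 = (ps 0 i * (Num.sqrt mu / 2)) ^+ 2.
      by rewrite exprMn expr_div_n sqr_sqrtr ?ltW //; field.
    rewrite ler_sqr ?nnegrE ?rp ?(ltW r0) // mulr_ge0 ?ltW // divr_gt0 // sqrtr_gt0 //.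
  have h4 : mu * (x 0 i - ps 0 i) ^+ 2 <= mu * (9 / 16 * ps 0 i ^+ 2).
    by have := ler_wpM2l (ltW mu0) h1; lra.
  rewrite ler_pM2l // in h4; rewrite ltNge; apply/negP => xneg; nra.
split=> //.
have [i0 i0S] := Sstar_neq0 opt nondeg.
(* The least weight on S is an admissible radius: a smaller displacement cannot make any coordinate
   negative. *)
pose m := \big[Num.min/1]_(i in S) x 0 i.
have m0 : 0 < m by apply/bigmin_gtP; split.
have mle i : i \in S -> m <= x 0 i by move=> iS; exact: bigmin_le_cond.
exists m => // y [k [z [l [Fz l1 yE]]]] hy.
have yi i : y 0 i = \sum_(j < k) l j * z j 0 i.
  by rewrite yE summxE; apply: eq_bigr => j _; rewrite mxE.
have sy : supp y \subset S.
  apply: suppP => i iS; rewrite yi big1 // => j _.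
  by case: (Fz j) => _ /supp_out ->; rewrite ?mulr0.
split=> //; split=> [i|].
  have [iS|iS] := boolP (i \in S); last by rewrite (supp_out sy iS).
  have : (y 0 i - x 0 i) ^+ 2 < m ^+ 2.
    have : enorm (y - x) ^+ 2 < m ^+ 2.
      by rewrite ltr_sqr ?nnegrE ?(ltW m0) ?sqrtr_ge0.
    rewrite enorm_sqr; apply: le_lt_trans.
    rewrite dotvE (bigD1 i) //= row_subE -expr2 lerDl sumr_ge0 // => j _.
    by rewrite -expr2 sqr_ge0.
  have := mle i iS; have := xpos i iS => p1 p2 p3.
  rewrite leNgt; apply/negP => yneg; nra.
under eq_bigr do rewrite yi; rewrite exchange_big /= -l1.
apply: eq_bigr => j _; rewrite -mulr_sumr.
by case: (Fz j) => -[_ ->] _; rewrite mulr1.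
Qed.

End FacialReturn.

(** * Number of cycles and queries until the test passes *)

Section FacialTermination.
Variables (R : realType) (n d : nat) (A : 'M[R]_(n, d)) (ps : 'rV[R]_n).
Hypothesis opt : optimal_design A ps.
Hypothesis nondeg : nondegenerate_design A ps.
Hypothesis zs_neq0 : zero_sum (R:=R) (Sstar A ps) <> [set 0].
Variables (eps : R) (x0 : 'rV[R]_n).
Hypothesis eps01 : 0 < eps < 1.
Hypothesis warm0 : warm A ps x0.

Let S := Sstar A ps.
Let Ll := L_loc A ps.
Let kl := kappa_loc A ps.

Lemma ln2_ge_half : 2^-1 <= ln (2 : R).
Proof.
have h : -1 < - (1 / 2) :> R by lra.
have := le_ln1Dx h; have -> : 1 + - (1 / 2) = 2^-1 :> R by lra.
by rewrite lnV ?posrE //; lra.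
Qed.

Lemma Theta_ge2 : 2 <= Theta_A A ps.
Proof. by rewrite lerDr divr_ge0 // sqrtr_ge0. Qed.

(** The summand 2 in [Theta_A] guarantees an instance-free lower bound on the logarithm, which
    absorbs rounding and the additive query. *)
Lemma ln_ratio_ge_half : 2^-1 <= ln (Theta_A A ps / eps).
Proof.
apply: le_trans ln2_ge_half _; case/andP: eps01 => e0 e1; have := Theta_ge2 => T2.
rewrite ler_ln ?posrE ?divr_gt0 //; last by lra.
by rewrite ler_pdivlMr //; lra.
Qed.

Lemma sqrt_kappa_ge1 : 1 <= Num.sqrt (kappa A ps).
Proof.
have k1 := kappa_ge1 opt nondeg zs_neq0.
by rewrite -ler_sqr ?nnegrE ?sqrtr_ge0 // sqr_sqrtr ?expr1n //; lra.
Qed.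

Lemma warm_facial_point j : warm A ps (facial_point A S Ll kl x0 j) /\
  excess A ps (facial_point A S Ll kl x0 j) <= c_0 A ps / 2 ^+ j.
Proof.
elim: j => [|j [wj ej]].
  rewrite /facial_point /= expr0 divr1; split=> //.
  by case: warm0 => _ _; rewrite le_min => /andP[].
have [w' e'] := warm_cycle opt nondeg zs_neq0 wj.
rewrite /facial_point iterS; split=> //; apply: le_trans e' _.
rewrite exprSr invfM mulrA ler_wpM2r //.
Qed.

(** By [warm_gap] it suffices that 18 L^2 c_0 / mu <= (eps d)^2 2^r. Since L_loc kappa_loc = 36 L^2
    / mu, the square of Theta_A / eps covers this with a factor 2 to spare. *)
Lemma cycles_enough (r : nat) : (Theta_A A ps / eps) ^+ 2 <= 2 ^+ r ->
  (maxgap A (facial_point A S Ll kl x0 r) <= (eps * d%:R)%:E)%E.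
Proof.
move=> hr; have [wr er] := warm_facial_point r; case/andP: eps01 => e0 e1.
have d2 := dim_ge2R opt nondeg zs_neq0.
have mu0 := mu_star_gt0 opt nondeg zs_neq0.
have L0 := L_star_gt0 opt nondeg zs_neq0.
have c0 := c_0_gt0 opt nondeg zs_neq0.
have ed : 0 < eps * d%:R by rewrite mulr_gt0 //; lra.
apply: (warm_gap opt nondeg zs_neq0 wr (ltW ed)).
set Q := 18 * L_star A ps ^+ 2 / mu_star A ps.
have Q0 : 0 < Q by rewrite divr_gt0 // mulr_gt0 // exprn_gt0.
apply: le_trans (ler_wpM2l (ltW Q0) er) _.
have p0 : 0 < 2 ^+ r :> R by rewrite exprn_gt0.
rewrite mulrA ler_pdivrMr //.
have QE : L_loc A ps * kappa_loc A ps * c_0 A ps = 2 * (Q * c_0 A ps).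
  rewrite kappa_locE // /L_loc /kappa /Q.
  by field; rewrite gt_eqF.
have Qc : 0 < Q * c_0 A ps by rewrite mulr_gt0.
pose s := Num.sqrt (L_loc A ps * kappa_loc A ps * c_0 A ps).
have ss : s ^+ 2 = 2 * (Q * c_0 A ps) by rewrite sqr_sqrtr QE //; lra.
have s0 : 0 <= s by exact: sqrtr_ge0.
have h : (s / (eps * d%:R)) ^+ 2 <= 2 ^+ r.
  apply: le_trans hr; rewrite ler_sqr ?nnegrE.
  - rewrite /Theta_A -/s.
    have -> : s / (eps * d%:R) = s / d%:R / eps by rewrite invfM mulrA mulrAC.
    by rewrite ler_pM2r ?invr_gt0 //; lra.
  - by rewrite divr_ge0 // ltW.
  - by rewrite divr_ge0 ?ltW //; have := Theta_ge2; lra.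
rewrite expr_div_n ler_pdivrMr ?exprn_gt0 // ss in h.
by rewrite mulrC; lra.
Qed.

Lemma cycles_bound : exists r : nat, [/\ (0 < r)%N,
  (Theta_A A ps / eps) ^+ 2 <= 2 ^+ r & r%:R <= 6 * ln (Theta_A A ps / eps)].
Proof.
set X := ln _; have X2 : 2^-1 <= X := ln_ratio_ge_half.
have l2 := ln2_ge_half; case/andP: eps01 => e0 e1.
have T0 : 0 < Theta_A A ps / eps by rewrite divr_gt0 //; have := Theta_ge2; lra.
(* The real exponent for which 2^z equals the squared ratio. Rounding up yields at most 4 X + 1 <= 6
   X. *)
set z := 2 * X / ln 2.
have z0 : 0 < z by rewrite divr_gt0 //; lra.
have z4 : z <= 4 * X by rewrite ler_pdivrMr; [nra | lra].
have /andP[] := real_ceil_itv (num_real z).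
case: (Num.ceil z) => [m|m]; last first.
  by rewrite NegzE intrN => _ h; have : 0 <= m.+1%:~R :> R by []; lra.
rewrite intrB -pmulrn => h1 h2; exists m; split.
- by rewrite -(ltr_nat R); lra.
- rewrite -ler_ln ?posrE ?exprn_gt0 // !lnXn // -/X.
  rewrite -[X *+ 2]mulr_natl -[ln 2 *+ m]mulr_natl.
  have zE : z * ln 2 = 2 * X by rewrite /z divfK // gt_eqF //; lra.
  by rewrite -zE ler_wpM2r //; lra.
- by lra.
Qed.

Lemma size_facial_queries r :
  size (facial_queries A S Ll kl x0 r) = (r * (cycle_len kl).+1)%N.
Proof.
rewrite /facial_queries size_flatten /shape -map_comp.
rewrite (eq_map (g := fun=> (cycle_len kl).+1)); last first.
  by move=> j /=; rewrite /cycle_queries size_rcons size_map size_iota.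
by rewrite -[in RHS](size_iota 0 r); elim: (iota 0 r) => //= a s ->; rewrite mulSn.
Qed.

(** The phase returns at the first passed test, so r is the least passing index. The constant 60 is
    6 for the cycle count times 10 for the queries per cycle. *)
Lemma facial_phase : exists r : nat,
  let out := facial_point A S Ll kl x0 r in
  [/\ facial_return A S Ll kl eps x0 r, warm A ps out,
      (maxgap A out <= (eps * d%:R)%:E)%E,
      (size (facial_queries A S Ll kl x0 r))%:R <=
        60 * (Num.sqrt (kappa A ps) * ln (Theta_A A ps / eps)) &
      forall w, w \in facial_queries A S Ll kl x0 r ->
        supp w \subset S /\ posdef (infoM A w)].
Proof.
have [r0 [r0p hr0 r0le]] := cycles_bound.
pose Pr r := (0 < r)%N && (maxgap A (facial_point A S Ll kl x0 r) <= (eps * d%:R)%:E)%E.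
have exr : exists r, Pr r by exists r0; rewrite /Pr r0p cycles_enough.
case: (ex_minnP exr) => r /andP[rp hr] rmin; exists r => /=.
have rr0 : (r <= r0)%N by apply: rmin; rewrite /Pr r0p cycles_enough.
split=> //.
- split=> // j /andP[j0 jr]; apply/negP => hj.
  by have := rmin j; rewrite /Pr j0 hj leqNgt jr => /(_ isT).
- by have [] := warm_facial_point r.
- rewrite size_facial_queries natrM.
  have [_ _ hN] := cycle_lenP opt nondeg zs_neq0; rewrite -/kl in hN.
  have h1 : r%:R <= 6 * ln (Theta_A A ps / eps) by apply: le_trans r0le; rewrite ler_nat.
  have := ler_pM (ler0n R r) (ler0n R _) h1 hN; lra.
- move=> w /flattenP[s /mapP[j _ ->] ws].
  by have [wj _] := warm_facial_point j; exact: (warm_queries opt nondeg zs_neq0 wj ws).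
Qed.

End FacialTermination.

(** * Away-step Frank-Wolfe *)

Section RankOneStep.
Variables (R : realType) (n d : nat) (A : 'M[R]_(n, d)).
Implicit Types p q : 'rV[R]_n.

(** The matrix determinant lemma, from two block-triangular factorizations of one bordered
    matrix. *)
Lemma det_add_rank1 (c : R) (b : 'rV[R]_d) :
  \det (1%:M + c *: (b^T *m b)) = 1 + c * dotv b b.
Proof.
pose x : 'cV[R]_d := c *: b^T.
pose Z : 'M[R]_(1 + d) := block_mx 1%:M b (- x) 1%:M.
have e1 : Z = block_mx 1%:M 0 (- x) 1%:M *m block_mx 1%:M b 0 (1%:M + x *m b).
  rewrite mulmx_block !(mulmx1, mul1mx, mul0mx, mulmx0, addr0, add0r) mulNmx.
  by rewrite addrC addrK.
have e2 : Z = block_mx 1%:M b 0 1%:M *m block_mx (1%:M + b *m x) 0 (- x) 1%:M.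
  rewrite mulmx_block !(mulmx1, mul1mx, mul0mx, mulmx0, addr0, add0r) mulmxN.
  by rewrite addrK.
have := congr1 determinant e1; rewrite e2 !det_mulmx !det_ublock !det_lblock !det1.
rewrite !mul1r mulr1 /x -scalemxAl => <-.
by rewrite -scalemxAr det_mx11 mxE [1%:M 0 0]mxE eqxx mulr1n [X in _ + X]mxE.
Qed.

(** Both step types are covered: an away step of size g is s = - g. When s < 0, definiteness comes
    from Cauchy-Schwarz and the positivity of 1 - s + s v. *)
Lemma rank1_step p (s : R) j (v := lev A p j)
    (p' := (1 - s) *: p + s *: delta_mx 0 j) :
  posdef (infoM A p) -> 0 < 1 - s -> 0 < 1 - s + s * v ->
  posdef (infoM A p') /\
  fdes A p' = fdes A p - (d%:R - 1) * ln (1 - s) - ln (1 - s + s * v).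
Proof.
move=> pp s1 sv.
have [W [l [e _]]] := pencil_spectral pp (trmx0 R d d).
have [uW inv] := congr1_unit e.
pose b := row j A *m W^T.
have vE : v = dotv b b.
  by rewrite /v /lev inv /b /dotv trmx_mul trmxK !mulmxA.
have e' : W *m infoM A p' *m W^T = (1 - s) *: 1%:M + s *: (b^T *m b).
  rewrite /p' infoMD !infoMZ infoM_delta mulmxDr mulmxDl -!scalemxAr -!scalemxAl e.
  by rewrite /b trmx_mul trmxK !mulmxA.
have quad (z : 'rV_d) : (z *m (W *m infoM A p' *m W^T) *m z^T) 0 0 =
    (1 - s) * dotv z z + s * dotv z b ^+ 2.
  rewrite e' mulmxDr mulmxDl -!scalemxAr -!scalemxAl mulmx1 mxE.
  rewrite !row_scaleE; congr (_ * _ + _ * _).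
  have -> : z *m (b^T *m b) *m z^T = (z *m b^T) *m (b *m z^T) by rewrite !mulmxA.
  by rewrite [z *m b^T]mx11_scalar mul_scalar_mx row_scaleE expr2 {2}dotvC.
have pos (z : 'rV_d) : z != 0 -> 0 < (z *m (W *m infoM A p' *m W^T) *m z^T) 0 0.
  move=> /dotv_gt0 z0; rewrite quad; have cs := cauchy_schwarz z b.
  have [s0|s0] := lerP 0 s.
    by rewrite ltr_wpDr ?mulr_gt0 // mulr_ge0 // sqr_ge0.
  have h1 : s * (dotv z z * dotv b b) <= s * dotv z b ^+ 2 by rewrite ler_nM2l.
  have h2 : 0 < dotv z z * (1 - s + s * dotv b b) by rewrite mulr_gt0 // -vE.
  lra.
split.
  split; first exact: infoM_sym.
  move=> x x0; have [z xE] : exists z : 'rV_d, x = z *m W.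
    by exists (x *m invmx W); rewrite mulmxKV.
  have z0 : z != 0 by apply: contra_neq x0 => z0; rewrite xE z0 mul0mx.
  by have := pos z z0; rewrite xE trmx_mul !mulmxA.
have detW : \det W ^+ 2 * \det (infoM A p) = 1.
  by have := congr1 determinant e; rewrite !det_mulmx det_tr det1 => <-; ring.
have dp := posdef_det_gt0 pp.
have det' : \det (infoM A p') = \det (infoM A p) * ((1 - s) ^+ d * (1 + s / (1 - s) * v)).
  have := congr1 determinant e'; rewrite !det_mulmx det_tr.
  have -> : (1 - s) *: 1%:M + s *: (b^T *m b) =
      (1 - s) *: (1%:M + (s / (1 - s)) *: (b^T *m b)).
    by rewrite scalerDr scalerA mulrCA divff ?mulr1 // gt_eqF.
  rewrite detZ det_add_rank1 -vE => <-.
  by rewrite -[LHS]mul1r -detW; ring.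
have v1 : 1 + s / (1 - s) * v = (1 - s + s * v) / (1 - s) by field; rewrite gt_eqF.
have q1 : 0 < (1 - s) ^+ d by rewrite exprn_gt0.
have q2 : 0 < (1 - s + s * v) / (1 - s) by rewrite divr_gt0.
have q3 : 0 < (1 - s) ^+ d * ((1 - s + s * v) / (1 - s)) by rewrite mulr_gt0.
rewrite /fdes det' v1 lnM ?posrE // lnM ?posrE // lnXn // ln_div ?posrE //.
by rewrite -mulr_natl; ring.
Qed.

Let D : R := d%:R.

(* Exact line search: the same formula covers toward steps (v > d, s > 0) and
   away steps (v < d, s < 0). *)
Lemma exact_step_gain (v s : R) (x := (v - D) / (v * (D - 1))) :
  2 <= D -> 1 < v -> s = (v - D) / (D * (v - 1)) ->
  [/\ 0 < 1 - s, 0 < 1 - s + s * v, -1 < x &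
      (D - 1) * zeta x <= (D - 1) * ln (1 - s) + ln (1 - s + s * v)].
Proof.
move=> D2 v1 sE.
have e1 : 1 - s = v * (D - 1) / (D * (v - 1)) by rewrite sE; field; apply/andP; split; lra.
have e2 : 1 - s + s * v = v / D by rewrite sE; field; apply/andP; split; lra.
have e3 : 1 + x = D * (v - 1) / (v * (D - 1)) by rewrite /x; field; apply/andP; split; lra.
have h1 : 0 < v * (D - 1) by rewrite mulr_gt0; lra.
have h2 : 0 < D * (v - 1) by rewrite mulr_gt0; lra.
have p1 : 0 < 1 - s by rewrite e1 divr_gt0.
have p2 : 0 < 1 - s + s * v by rewrite e2 divr_gt0; lra.
have p3 : 0 < 1 + x by rewrite e3 divr_gt0.
split=> //; first by lra.
(* Here 1 - s = 1 / (1 + x) and 1 - s + s v = v / D. Applying ln u <= u - 1 to D / v produces the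
   linear term (D - 1) x that completes [zeta]. *)
have -> : ln (1 - s) = - ln (1 + x) by rewrite -lnV ?posrE // e1 e3 invf_div.
have Dv : 0 < D / v by rewrite divr_gt0 //; lra.
have hb : -1 < D / v - 1 by lra.
have := le_ln1Dx hb; rewrite addrC subrK.
have -> : ln (D / v) = - ln (1 - s + s * v).
  by rewrite -lnV ?posrE // e2 invf_div.
have e4 : (D - 1) * x = 1 - D / v by rewrite /x; field; apply/andP; split; lra.
rewrite /zeta mulrBr e4; lra.
Qed.

(** For v <= 1 both logarithms are nonnegative. For v > 1, ln u >= 1 - 1/u reduces the claim to the
    sign of (D - v) - g D (v - 1), nonnegative exactly when g does not exceed the exact step. *)
Lemma away_step_gain_ge0 (v g : R) : 2 <= D -> 0 <= v -> v <= D -> 0 <= g ->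
  (1 < v -> g <= (D - v) / (D * (v - 1))) ->
  [/\ 0 < 1 + g, 0 < 1 + g - g * v &
   0 <= (D - 1) * ln (1 + g) + ln (1 + g - g * v)].
Proof.
move=> D2 v0 vD g0 hg; have g1 : 0 < 1 + g by lra.
have lg : 0 <= ln (1 + g) by rewrite ln_ge0; lra.
have [v1|v1] := lerP v 1.
  have gv : 0 <= g * (1 - v) by rewrite mulr_ge0 //; lra.
  have h : 1 <= 1 + g - g * v by lra.
  split=> //; first by lra.
  by rewrite addr_ge0 ?mulr_ge0 ?ln_ge0 //; lra.
have h0 : 0 < D * (v - 1) by rewrite mulr_gt0; lra.
have := hg v1; rewrite ler_pdivlMr // => h1.
have h2 : 0 < 1 + g - g * v by nra.
split=> //.
have lnge (u : R) : 0 < u -> 1 - u^-1 <= ln u.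
  move=> u0; have ui : 0 < u^-1 by rewrite invr_gt0.
  have hu : -1 < u^-1 - 1 by lra.
  by have := le_ln1Dx hu; rewrite addrC subrK lnV ?posrE //; lra.
have k1 := lnge _ g1; have k2 := lnge _ h2.
have k3 : 0 <= (D - 1) * (1 - (1 + g)^-1) + (1 - (1 + g - g * v)^-1).
  have -> : (D - 1) * (1 - (1 + g)^-1) + (1 - (1 + g - g * v)^-1) =
     g * ((D - v) - g * (D * (v - 1))) / ((1 + g) * (1 + g - g * v)).
    by field; apply/andP; split; lra.
  by rewrite divr_ge0 ?mulr_ge0 ?mulr_gt0 //; lra.
apply: le_trans k3 _; rewrite lerD // ler_wpM2l //; lra.
Qed.

End RankOneStep.

Section AwayStepFrankWolfe.
Variables (R : realType) (n d : nat) (A : 'M[R]_(n, d)).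
Hypothesis d_ge2 : (2 <= d)%N.
Implicit Types p q : 'rV[R]_n.

Lemma natr_ge2 : 2 <= d%:R :> R.
Proof. by rewrite ler_nat. Qed.

Definition design p : Prop := simplex p /\ posdef (infoM A p).

(** A guaranteed decrease of [fdes] in an unclipped line-search step, toward or away, at an index of
    leverage v. *)
Definition gain (v : R) : R :=
  (d%:R - 1) * zeta ((v - d%:R) / (v * (d%:R - 1))).

Lemma sum_delta j : \sum_i (delta_mx 0 j : 'rV[R]_n) 0 i = 1.
Proof.
rewrite (bigD1 j) //= mxE !eqxx big1 ?addr0 // => i ij.
by rewrite mxE (negbTE ij) andbF.
Qed.

Lemma gain_ge0 v : 1 < v -> 0 <= gain v.
Proof.
move=> v1; have d2 := natr_ge2; have [_ _ h _] := exact_step_gain d2 v1 erefl.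
by apply: mulr_ge0; [lra | exact: zeta_ge0].
Qed.

(** The argument of [zeta] in [gain v] has absolute value at least 2 x on either side of d. Halving
    leaves it strictly above x, so [zeta_le_norm] excludes a smaller gain. *)
Lemma gain_ge (eta v : R) (x := eta / ((d%:R + eta) * (d%:R - 1)) / 2) :
  0 < eta -> 1 < v -> (eta < v - d%:R \/ eta < d%:R - v) ->
  0 < x /\ (d%:R - 1) * zeta x <= gain v.
Proof.
move=> e0 v1 hv; have d2 := natr_ge2; have h1 : 0 < (d%:R + eta) * (d%:R - 1) by rewrite mulr_gt0; lra.
have x0 : 0 < x by rewrite divr_gt0 // divr_gt0.
have x1 : x < 1.
  by rewrite /x ltr_pdivrMr // ltr_pdivrMr //; nra.
split=> //; rewrite ler_wpM2l //; first by lra.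
have [_ _ h _] := exact_step_gain d2 v1 erefl.
rewrite leNgt; apply/negP => /ltW hz.
have x01 : 0 <= x < 1 by lra.
have := zeta_le_norm h x01 hz; apply/negP; rewrite -ltNge.
have h2 : 0 < v * (d%:R - 1) by rewrite mulr_gt0; lra.
have h3 : 2 * x = eta / ((d%:R + eta) * (d%:R - 1)) by rewrite /x mulrC divfK // lt0r_neq0.
have : 2 * x <= `|(v - d%:R) / (v * (d%:R - 1))|; last by lra.
rewrite h3 normrM normfV (gtr0_norm h2) ler_pdivrMr // mulrAC ler_pdivlMr //.
rewrite !mulrA ler_pM2r; last by lra.
case: hv => hv.
  by rewrite gtr0_norm; [nra | lra].
by rewrite ltr0_norm; [nra | lra].
Qed.

Lemma lev_max_ge p jp : design p -> (forall i, lev A p i <= lev A p jp) ->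
  d%:R <= lev A p jp.
Proof.
move=> [[p0 p1] pp] h; rewrite -(sum_lev pp) -[leRHS]mul1r -p1 mulr_suml.
by apply: ler_sum => i _; rewrite ler_wpM2l.
Qed.

Lemma simplex_le1 p i : simplex p -> p 0 i <= 1.
Proof. by move=> [p0 <-]; rewrite (bigD1 i) //= lerDl sumr_ge0. Qed.

(** If p_j = 1, the identity sum_i p_i v_i = d forces v_j = d. So the maximal away step is well
    defined. *)
Lemma weight_lt1 p j : design p -> lev A p j < d%:R -> p 0 j < 1.
Proof.
move=> [sp pp] hj; rewrite lt_neqAle simplex_le1 // andbT.
apply: contraTneq hj => pj; rewrite -leNgt -(sum_lev pp).
case: sp => p0; rewrite (bigD1 j) //= pj => e.
have : \sum_(i < n | i != j) p 0 i = 0 by lra.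
move/eqP; rewrite psumr_eq0 // => /allP h.
rewrite (bigD1 j) //= pj mul1r big1 ?addr0 // => i ij.
by have := h i (mem_index_enum _); rewrite ij => /eqP ->; rewrite mul0r.
Qed.

(** The cases are toward, unclipped away and drop. A drop guarantees no decrease but clears [jm];
    only a toward step can enlarge the support, and only by [jp]. *)
Lemma afw_stepP p p' : design p -> afw_step A p p' -> design p' /\
  exists jp jm, [/\ forall i, lev A p i <= lev A p jp, 0 < p 0 jm,
    forall i, 0 < p 0 i -> lev A p jm <= lev A p i &
    [\/ [/\ d%:R - lev A p jm <= lev A p jp - d%:R,
            fdes A p' <= fdes A p - gain (lev A p jp) &
            forall i, i != jp -> p 0 i = 0 -> p' 0 i = 0],
        [/\ lev A p jp - d%:R < d%:R - lev A p jm,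
            1 < lev A p jm /\
            (d%:R - lev A p jm) / (d%:R * (lev A p jm - 1)) <= p 0 jm / (1 - p 0 jm),
            fdes A p' <= fdes A p - gain (lev A p jm) &
            forall i, p 0 i = 0 -> p' 0 i = 0] |
        [/\ lev A p jp - d%:R < d%:R - lev A p jm,
            fdes A p' <= fdes A p, p' 0 jm = 0 &
            forall i, p 0 i = 0 -> p' 0 i = 0]]].
Proof.
have d2 := natr_ge2; move=> Dp [jp [jm [hmax pjm hmin ->]]]; have [[p0 p1] pp] := Dp.
have hjp := lev_max_ge Dp hmax.
rewrite /afw_update; set vp := lev A p jp in hmax hjp *; set vm := lev A p jm in hmin *.
case: ifPn => [toward|]; last rewrite -ltNge => away.
  set g := ls_step _ _.
  have vp1 : 1 < vp by lra.
  have [s1 sv x1 hg] := exact_step_gain d2 vp1 (erefl g).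
  have g0 : 0 <= g by rewrite divr_ge0 ?mulr_ge0 //; lra.
  have [pp' fE] := rank1_step pp s1 sv.
  split; first split=> //; first split.
  - move=> i; rewrite row_addE !row_scaleE [delta_mx _ _ _ _]mxE.
    by apply: addr_ge0; apply: mulr_ge0; rewrite ?ler0n //; exact: ltW.
  - under eq_bigr do rewrite row_addE !row_scaleE.
    by rewrite big_split /= -!mulr_sumr p1 sum_delta; ring.
  exists jp, jm; split=> //; apply: Or31; split=> //.
    by rewrite fE /gain -/vp; lra.
  move=> i ij pi; rewrite row_addE !row_scaleE pi mxE (negbTE ij) andbF.
  by rewrite !mulr0 addr0.
have vmd : vm < d%:R by lra.
have vm0 : 0 <= vm by exact: lev_ge0.
have pjm1 : p 0 jm < 1 := weight_lt1 Dp vmd.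
set g := away_step _ _ _.
have gmax0 : 0 <= p 0 jm / (1 - p 0 jm) by rewrite divr_ge0 ?ltW //; lra.
have g_le : g <= p 0 jm / (1 - p 0 jm).
  by rewrite /g /away_step; case: ifP => // _; rewrite ge_min lexx orbT.
have g0 : 0 <= g.
  rewrite /g /away_step; case: ifP => // vm1; rewrite le_min gmax0 andbT.
  by rewrite divr_ge0 ?mulr_ge0 //; lra.
have g_ls : 1 < vm -> g <= (d%:R - vm) / (d%:R * (vm - 1)).
  by move=> vm1; rewrite /g /away_step vm1 ge_min lexx.
have updE : (1 + g) *: p - g *: delta_mx 0 jm =
    (1 - (- g)) *: p + (- g) *: delta_mx 0 jm by rewrite opprK scaleNr.
have [g1 gv gain0] := away_step_gain_ge0 d2 vm0 (ltW vmd) g0 g_ls.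
have s1 : 0 < 1 - (- g) by rewrite opprK.
have sv : 0 < 1 - (- g) + (- g) * vm by rewrite opprK mulNr.
have [pp' fE] := rank1_step pp s1 sv.
rewrite -updE opprK mulNr in pp' fE.
have ent i : ((1 + g) *: p - g *: delta_mx 0 jm) 0 i = (1 + g) * p 0 i - g * (i == jm)%:R.
  by rewrite row_subE !row_scaleE [delta_mx _ _ _ _]mxE eqxx.
have zero i : p 0 i = 0 -> ((1 + g) *: p - g *: delta_mx 0 jm) 0 i = 0.
  move=> pi; rewrite ent pi mulr0 sub0r; case: eqP => [ij|_]; last by rewrite mulr0 oppr0.
  by rewrite ij in pi; rewrite pi ltxx in pjm.
have gp : g * (1 - p 0 jm) <= p 0 jm by rewrite -ler_pdivlMr //; lra.
split.
  split=> //; split=> [i|].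
    rewrite ent; case: eqP => [->|_]; first by rewrite mulr1; lra.
    by rewrite mulr0 subr0 mulr_ge0 // ltW.
  under eq_bigr do rewrite ent.
  rewrite sumrB -!mulr_sumr p1 (bigD1 jm) //= eqxx big1 ?addr0; first by rewrite /=; ring.
  by move=> i /negbTE ->.
exists jp, jm; split=> //.
(* When either conjunct fails, including v <= 1, the maximal step is taken, and it empties
   coordinate [jm]. *)
have [exact|drop] := boolP ((1 < vm) && ((d%:R - vm) / (d%:R * (vm - 1)) <= p 0 jm / (1 - p 0 jm))).
  apply: Or32; case/andP: exact => vm1 hle; split=> //.
  have gE : g = (d%:R - vm) / (d%:R * (vm - 1)).
    by rewrite /g /away_step vm1; apply/min_idPl.
  have sE : - g = (vm - d%:R) / (d%:R * (vm - 1)) by rewrite gE -mulNr opprB.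
  have [_ _ _] := exact_step_gain d2 vm1 sE; rewrite fE /gain -/vm opprK mulNr; lra.
apply: Or33; split=> //; first by rewrite fE -/vm; lra.
have gE : g = p 0 jm / (1 - p 0 jm).
  move: drop; rewrite /g /away_step negb_and; case: ifP => //= vm1.
  by rewrite -ltNge => /ltW h; apply/min_idPr.
by rewrite ent eqxx mulr1 gE; field; lra.
Qed.

End AwayStepFrankWolfe.

(** * Nonsingularity of the volumetric initialization *)

Section VolumetricInitialization.
Variables (R : realType) (n d : nat) (A : 'M[R]_(n, d)).

Lemma quad_infoM (p : 'rV[R]_n) (x : 'rV[R]_d) :
  (x *m infoM A p *m x^T) 0 0 = \sum_i p 0 i * dotv x (row i A) ^+ 2.
Proof.
rewrite /infoM mulmx_sumr mulmx_suml summxE; apply: eq_bigr => i _.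
rewrite -scalemxAr -scalemxAl row_scaleE; congr (_ * _).
have -> : x *m ((row i A)^T *m row i A) *m x^T =
    (x *m (row i A)^T) *m (row i A *m x^T) by rewrite !mulmxA.
by rewrite [x *m _]mx11_scalar mul_scalar_mx row_scaleE expr2 {2}dotvC.
Qed.

(** The matrix of products dir_k . u_j is triangular with nonzero diagonal, so the u_k form a basis.
    They lie in the span of the selected rows, so a vector orthogonal to those rows is 0. *)
Lemma ky_init_design (p : 'rV[R]_n) : (0 < d)%N -> ky_init A p -> design A p.
Proof.
move=> d0 [dir [u [a [b [_ _ hu dir_ortho ->]]]]].
set B := (_ :|: _)%SET.
have aB k : a k \in B by apply/setUP; left; apply: imset_f.
have bB k : b k \in B by apply/setUP; right; apply: imset_f.
have cB : (0 < #|B|)%N by rewrite card_gt0; apply/set0Pn; exists (a (Ordinal d0)).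
have iB : 0 < #|B|%:R^-1 :> R by rewrite invr_gt0 ltr0n.
have ent i : uniform_on R B 0 i = if i \in B then #|B|%:R^-1 else 0 by rewrite mxE.
have ge0 i : 0 <= uniform_on R B 0 i by rewrite ent; case: ifP => // _; exact: ltW.
split; first split=> //.
  under eq_bigr do rewrite ent; rewrite -big_mkcond sumr_const.
  by rewrite -[LHS]mulr_natr mulVf // pnatr_eq0 -lt0n.
split; first exact: infoM_sym.
move=> x x0; rewrite quad_infoM lt_neqAle eq_sym.
have term i : 0 <= uniform_on R B 0 i * dotv x (row i A) ^+ 2.
  by rewrite mulr_ge0 ?sqr_ge0.
rewrite sumr_ge0 // andbT; apply: contra_neq x0 => /eqP.
rewrite psumr_eq0 // => /allP h.
have orth i : i \in B -> dotv x (row i A) = 0.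
  move=> iB'; have := h i (mem_index_enum _); rewrite /= ent iB' mulf_eq0.
  by rewrite (gt_eqF iB) /= expf_eq0 => /eqP.
pose U : 'M[R]_d := \matrix_k u k; pose G := (\matrix_k dir k) *m U^T.
have GE k j : G k j = dotv (dir k) (u j).
  by rewrite /G mxE /dotv mxE; apply: eq_bigr => l _; rewrite !mxE.
have uG : G^T \in unitmx.
  rewrite unitmxE det_trig ?unitfE; last first.
    by apply/is_trig_mxP => j k jk; rewrite mxE GE dir_ortho.
  by apply/prodf_neq0 => k _; rewrite mxE GE; case: (hu k).
have xU : x *m U^T = 0.
  apply/rowP => k; rewrite mxE [RHS]mxE.
  transitivity (dotv x (u k)); first by rewrite /dotv mxE; apply: eq_bigr => l _; rewrite !mxE.
  case: (hu k) => /submxP[D ->] _; rewrite /dotv trmx_mul tr_col_mx mulmxA mul_mx_row.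
  have -> : x *m (row (a k) A)^T = 0.
    by apply/matrixP => s t; rewrite !ord1 [RHS]mxE; exact: orth.
  have -> : x *m (row (b k) A)^T = 0.
    by apply/matrixP => s t; rewrite !ord1 [RHS]mxE; exact: orth.
  by rewrite row_mx0 mul0mx mxE.
have uU : U \in unitmx.
  by move: uG; rewrite unitmx_tr /G unitmx_mul unitmx_tr => /andP[].
have := congr1 (mulmx^~ (invmx U^T)) xU.
by rewrite mul0mx mulmxK // unitmx_tr.
Qed.

End VolumetricInitialization.

(** * Convergence of the values and identification of the optimal face *)

Section AwayStepConvergence.
Variables (R : realType) (n d : nat) (A : 'M[R]_(n, d)) (ps : 'rV[R]_n).
Hypothesis opt : optimal_design A ps.
Hypothesis nondeg : nondegenerate_design A ps.
Hypothesis zs_neq0 : zero_sum (R:=R) (Sstar A ps) <> [set 0].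
Variable P : nat -> 'rV[R]_n.
Hypothesis seqP : afw_sequence A P.

Let S := Sstar A ps.
Let pps : posdef (infoM A ps) := opt_posdef opt.
Let d_ge2 : (2 <= d)%N := dim_ge2 opt nondeg zs_neq0.

Lemma afw_design k : design A (P k).
Proof.
case: seqP => P0 st; elim: k => [|k IH].
  by apply: ky_init_design P0; apply: leq_trans d_ge2.
by have [] := afw_stepP d_ge2 IH (st k).
Qed.

Lemma afw_monotone k : fdes A (P k.+1) <= fdes A (P k).
Proof.
have d2 := @natr_ge2 R _ d_ge2.
have [_ [jp [jm [hmax _ _ h]]]] := afw_stepP d_ge2 (afw_design k) (seqP.2 k).
have hjp := lev_max_ge (afw_design k) hmax.
case: h => [[_ h _]|[_ [v1 _] h _]|[_ h _ _] //]; apply: le_trans h _.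
  by rewrite gerBl gain_ge0 //; lra.
by rewrite gerBl gain_ge0.
Qed.

(** The Frank-Wolfe gap bounds the excess: this is the nonnegative divergence from p to [ps], with
    sum_i p_i v_i = d. *)
Lemma excess_le_gap p eta : design A p -> (forall i, lev A p i <= d%:R + eta) ->
  excess A ps p <= eta.
Proof.
move=> [_ pp] h; have := bregman_ge0 pp pps; rewrite /bregman /excess.
under eq_bigr do rewrite mulrBl; rewrite sumrB (sum_lev pp).
have [ps0 ps1] := opt_simplex opt.
have : \sum_i ps 0 i * lev A p i <= d%:R + eta.
  rewrite -[leRHS]mul1r -[X in X * _]ps1 mulr_suml; apply: ler_sum => i _.
  by rewrite ler_wpM2l.
lra.
Qed.

Lemma afw_gap_liminf eta : 0 < eta -> exists k, forall i, lev A (P k) i <= d%:R + eta.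
Proof.
move=> e0; apply: contrapT => hno; have d2 := @natr_ge2 R _ d_ge2.
have big k : exists i, d%:R + eta < lev A (P k) i.
  apply: contrapT => h; apply: hno; exists k => i; rewrite leNgt; apply/negP => hi.
  by apply: h; exists i.
pose x := eta / ((d%:R + eta) * (d%:R - 1)) / 2.
pose c := (d%:R - 1) * zeta x.
(* Any leverage above d + eta would do; only the positivity of x is kept. *)
have [x0 _] : 0 < x /\ c <= gain d (d%:R + eta + 1).
  by apply: gain_ge => //; [lra | left; lra].
have c0 : 0 < c by rewrite mulr_gt0 ?zeta_gt0 //; lra.
(* With weight c / 2, a toward step loses c and regains at most c / 2 through the support, an
   unclipped away step loses c, and a drop loses c / 2. So every step costs at least c / 2. *)
pose Phi k := fdes A (P k) + c / 2 * #|supp (P k)|%:R.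
have dec k : Phi k.+1 <= Phi k - c / 2.
  have Dk := afw_design k.
  have [_ [jp [jm [hmax pjm _ h]]]] := afw_stepP d_ge2 Dk (seqP.2 k).
  have hjp : d%:R + eta < lev A (P k) jp.
    by have [i hi] := big k; apply: lt_le_trans hi (hmax i).
  have cards (B C : {set 'I_n}) (a : nat) : (#|B| <= #|C| + a)%N -> #|B|%:R <= #|C|%:R + a%:R :> R.
    by rewrite -natrD ler_nat.
  case: h => [[_ hf hs]|[hgap [v1 _] hf hs]|[_ hf hz hs]].
  - have [_ hg] : 0 < x /\ c <= gain d (lev A (P k) jp).
      by apply: gain_ge => //; [lra | left; lra].
    have : (#|supp (P k.+1)| <= #|supp (P k)| + 1)%N.
      have := (leq_card_setU [set jp]%SET (supp (P k))).1; rewrite cards1 addnC.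
      apply: leq_trans; apply: subset_leq_card.
      apply/fintype.subsetP => i; rewrite !inE => hi.
      by case: eqVneq => //= ij; apply: contra_neq hi => pi; exact: hs.
    move=> /cards hc; have := ler_wpM2l (ltW c0) hc; rewrite /Phi; lra.
  - have [_ hg] : 0 < x /\ c <= gain d (lev A (P k) jm).
      by apply: gain_ge => //; right; lra.
    have : (#|supp (P k.+1)| <= #|supp (P k)| + 0)%N.
      rewrite addn0; apply: subset_leq_card; apply/fintype.subsetP => i; rewrite !inE.
      by apply: contra_neq => pi; exact: hs.
    move=> /cards hc; have := ler_wpM2l (ltW c0) hc; rewrite /Phi; lra.
  - have : (#|supp (P k.+1)| + 1 <= #|supp (P k)|)%N.
      rewrite addn1; apply: proper_card; apply/properP; split.
        apply/fintype.subsetP => i; rewrite !inE.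
        by apply: contra_neq => pi; exact: hs.
      by exists jm; rewrite !inE ?hz ?eqxx // gt_eqF.
    rewrite -(ler_nat R) natrD => hc; have := ler_wpM2l (ltW c0) hc; rewrite /Phi; lra.
have tot k : Phi k <= Phi 0%N - k%:R * (c / 2).
  elim: k => [|k IH]; first by rewrite mul0r subr0.
  by apply: le_trans (dec k) _; rewrite -[k.+1]addn1 natrD; lra.
have low k : fdes A ps <= Phi k.
  have [sk pk] := afw_design k; have := excess_ge0 opt nondeg sk pk; rewrite /excess => hk.
  have : 0 <= c / 2 * #|supp (P k)|%:R by rewrite mulr_ge0 ?ler0n //; lra.
  by rewrite /Phi; lra.
pose z := (Phi 0%N - fdes A ps) / (c / 2).
have z0 : 0 <= z by rewrite divr_ge0 ?subr_ge0 //; lra.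
have := archi_boundP z0; set k := Num.bound z => hk.
have := tot k; have := low k; rewrite /z ltr_pdivrMr in hk; last by lra.
lra.
Qed.

(** One index with a small gap is enough, because the value of f never increases afterwards. *)
Lemma afw_excess_small eta : 0 < eta ->
  exists K, forall k, (K <= k)%N -> excess A ps (P k) <= eta.
Proof.
move=> /afw_gap_liminf[K hK]; exists K => k /subnK <-.
elim: (k - K)%N => [|m IH]; first exact: excess_le_gap (afw_design K) hK.
by apply: le_trans IH; rewrite addSn lerD2r afw_monotone.
Qed.

Lemma afw_near r : 0 < r < 1 -> exists K, forall k, (K <= k)%N ->
  excess A ps (P k) <= zeta r /\
  forall i, lev A (P k) i <= lev A ps i / (1 - r) /\
            lev A ps i / (1 + r) <= lev A (P k) i.
Proof.
move=> /andP[r0 r1]; have [K hK] := afw_excess_small (zeta_gt0 r0).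
exists K => k /hK ex; split=> // i; have [sk pk] := afw_design k.
apply: lev_le_bregman => //; first by rewrite (ltW r0).
exact: le_trans (bregman_le_excess opt nondeg sk) ex.
Qed.

Lemma afw_K_gap e : 0 < e -> exists K, is_K_gap A e P K.
Proof.
(* Chosen so that 1 / (1 - r) = 1 + e, which turns v_i <= d at [ps] into v_i <= (1 + e) d. *)
move=> e0; pose r := e / (1 + e).
have r1 : 1 - r = (1 + e)^-1 by rewrite /r; field; lra.
have i0 : 0 < (1 + e)^-1 by rewrite invr_gt0; lra.
have r01 : 0 < r < 1 by rewrite divr_gt0 //; lra.
have [K hK] := afw_near r01; exists K => k /hK[_ h].
apply/maxgap_le => i; have [h1 _] := h i; apply: le_trans h1 _.
rewrite r1 invrK; have := lev_opt_le nondeg i => hi.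
have e1 : 0 <= 1 + e by lra.
by have := ler_wpM2r e1 hi; lra.
Qed.

Lemma afw_K_id : exists K, is_K_id S P K.
Proof.
have d2 := @natr_ge2 R _ d_ge2.
have [/andP[rb0 rb1] _ _] := rbarP opt nondeg zs_neq0.
(* With r = rho / 2, scores off S fall strictly below d - d rho while those on S stay within d rho
   of d. A support index off S therefore forces an away step at an index off S. *)
pose rho := rbar A ps; rewrite -/rho in rb0 rb1; pose r := rho / 2.
have r01 : 0 < r < 1 by rewrite /r; lra.
have [K hK] := afw_near r01.
have dr : 0 < d%:R * rho by rewrite mulr_gt0 //; lra.
have far k i : (K <= k)%N -> i \notin S ->
    lev A (P k) i < d%:R - d%:R * rho.
  move=> /hK[_ /(_ i)[h _]] iS; apply: le_lt_trans h _.
  have := rbar_out opt nondeg zs_neq0 iS; rewrite -/rho ltr_pdivrMr; last by lra.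
  have : 0 < d%:R * rho * rho by rewrite mulr_gt0.
  by rewrite /r; lra.
have upper k i : (K <= k)%N -> lev A (P k) i <= d%:R + d%:R * rho.
  move=> /hK[_ /(_ i)[h _]]; apply: le_trans h _; rewrite ler_pdivrMr; last by lra.
  have := lev_opt_le nondeg i; have : d%:R * rho * rho <= d%:R * rho / 2.
    by rewrite ler_wpM2l ?(ltW dr).
  by rewrite /r; lra.
have inner k i : (K <= k)%N -> i \in S -> d%:R - d%:R * rho <= lev A (P k) i.
  move=> /hK[_ /(_ i)[_ h]] iS; apply: le_trans h; rewrite (lev_Sstar iS).
  rewrite ler_pdivlMr; last by lra.
  have : 0 < d%:R * rho * rho by rewrite mulr_gt0.
  by rewrite /r; lra.
(* The slack term alone gives p_i (2 d rho) <= zeta r <= rho^2 / 8, hence the bound rho / (16 d). *)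
have light k i : (K <= k)%N -> i \notin S -> P k 0 i <= rho / (16 * d%:R).
  move=> kK iS; have [ex _] := hK k kK.
  have [[p0 p1] pk] := afw_design k.
  have := ex; rewrite (excess_bregman opt p1) => ex'.
  have b0 := bregman_ge0 pps pk.
  have h1 : P k 0 i * (d%:R - lev A ps i) <= \sum_j P k 0 j * (d%:R - lev A ps j).
    rewrite [leRHS](bigD1 i) //= lerDl sumr_ge0 // => j _.
    by rewrite mulr_ge0 // subr_ge0 (lev_opt_le nondeg).
  have h2 := ler_wpM2l (p0 i) (rbar_out opt nondeg zs_neq0 iS); rewrite -/rho in h2.
  have h3 : zeta r <= r ^+ 2 / 2 by apply: zeta_le_half_sqr; lra.
  have h4 : rho * (16 * d%:R * P k 0 i) <= rho * rho by rewrite /r in h3; lra.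
  by rewrite ler_pdivlMr; [rewrite ler_pM2l // in h4; lra | lra].
pose N k := #|supp (P k) :\: S|.
(* The predecessor covers both regimes: strict decrease while some support lies off S, and staying
   at 0 afterwards, since the toward index always lies in S. *)
have step k : (K <= k)%N -> (N k.+1 <= (N k).-1)%N.
  move=> kK; have Dk := afw_design k; have [[p0 p1] pk] := Dk.
  have [_ [jp [jm [hmax pjm hmin h]]]] := afw_stepP d_ge2 Dk (seqP.2 k).
  have hjp := lev_max_ge Dk hmax.
  have jpS : jp \in S.
    by apply: contraT => jpS; have := far k jp kK jpS; lra.
  have [N0|Npos] := posnP (N k).
    have sk : supp (P k) \subset S by rewrite -finset.setD_eq0 -cards_eq0 -/(N k) N0.
    rewrite N0 leqn0 cards_eq0 finset.setD_eq0.
    apply: suppP => i iS; have pi := supp_out sk iS.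
    by case: h => [[_ _ hs]|[_ _ _ hs]|[_ _ _ hs]]; apply: hs => //; apply: contraNneq iS => ->.
  have [i0 i0P] : exists i, i \in supp (P k) :\: S by apply/set0Pn; rewrite -card_gt0.
  have [i0S pi0] : i0 \notin S /\ 0 < P k 0 i0.
    by move: i0P; rewrite !inE => /andP[-> pi]; rewrite lt_neqAle eq_sym pi p0.
  have low : lev A (P k) jm < d%:R - d%:R * rho by apply: le_lt_trans (hmin _ pi0) (far k _ kK i0S).
  have jmS : jm \notin S by apply: contraTN low => jmS; rewrite -leNgt inner.
  have hi := upper k jp kK.
  case: h => [[hc _ _]|[_ [v1 hex] _ _]|[_ _ hz hs]]; first by lra.
    (* The unclipped case is impossible: p d (v - 1) <= p d^2 <= rho d / 16, whereas (d - v) (1 - p)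
       >= d rho / 2, so the line-search step exceeds the maximal step. *)
    have lt := light k jm kK jmS; exfalso; move: hex; apply/negP; rewrite -ltNge.
    have dd : 0 < 16 * d%:R :> R by lra.
    rewrite ler_pdivlMr // in lt.
    have w1 : P k 0 jm <= 1 / 2 by nra.
    rewrite ltr_pdivrMr; last by lra.
    rewrite mulrAC ltr_pdivlMr; last by rewrite mulr_gt0; lra.
    have t1 : P k 0 jm * (d%:R * (lev A (P k) jm - 1)) <= P k 0 jm * (d%:R * d%:R).
      by rewrite ler_wpM2l // ler_wpM2l //; lra.
    have t2 : 16 * (P k 0 jm * (d%:R * d%:R)) <= rho * d%:R by nra.
    have t3 : (d%:R * rho) * (1 / 2) <= (d%:R - lev A (P k) jm) * (1 - P k 0 jm).
      by apply: ler_pM; lra.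
    lra.
  rewrite -ltnS prednK //; apply: proper_card; apply/properP; split.
    apply/fintype.subsetP => i; rewrite !inE => /andP[-> pi] /=.
    by apply: contra_neq pi => pi; exact: hs.
  by exists jm; rewrite finset.in_setD jmS inE ?hz ?eqxx // gt_eqF.
exists (K + N K)%N => k hk.
have dec m : (N (K + m)%N <= N K - m)%N.
  elim: m => [|m IH]; first by rewrite addn0 subn0.
  rewrite addnS; apply: leq_trans (step _ (leq_addr _ _)) _.
  by rewrite subnS; case: (N (K + m)%N) IH => [|a] //= IH; rewrite -ltnS; apply: leq_trans IH _; case: (_ - _)%N.
have : N k == 0%N.
  have -> : k = (K + (k - K))%N by rewrite subnKC // (leq_trans _ hk) // leq_addr.
  rewrite -leqn0; apply: leq_trans (dec _) _; rewrite leqn0 subn_eq0.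
  by rewrite leq_subRL // (leq_trans _ hk) // leq_addr.
by rewrite cards_eq0 finset.setD_eq0.
Qed.

End AwayStepConvergence.

(** * Exit of the loop and the main theorem *)

Section LoopExit.
Variables (R : realType) (n d : nat) (A : 'M[R]_(n, d)) (ps : 'rV[R]_n).
Hypothesis opt : optimal_design A ps.
Hypothesis nondeg : nondegenerate_design A ps.
Hypothesis zs_neq0 : zero_sum (R:=R) (Sstar A ps) <> [set 0].

Let S := Sstar A ps.
Let c := tol A ps.

Lemma tol_gt0 : 0 < c.
Proof.
have k1 := kappa_ge1 opt nondeg zs_neq0.
rewrite lt_min c_0_gt0 //= divr_gt0 ?exprn_gt0 // ?/c_1; lra.
Qed.

Lemma tol_le_c_0 : c <= c_0 A ps.
Proof. by rewrite ge_min lexx. Qed.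

Lemma near_of_gap p : design A p -> (maxgap A p <= c%:E)%E ->
  excess A ps p <= c /\ forall i,
    lev A p i <= lev A ps i / (1 - rbar A ps) /\
    lev A ps i / (1 + rbar A ps) <= lev A p i.
Proof.
move=> Dp /maxgap_le h; have ex := excess_le_gap opt Dp h; have [sp pp] := Dp.
split=> // i; have [/andP[r0 r1] _ _] := rbarP opt nondeg zs_neq0.
apply: (lev_le_bregman i (opt_posdef opt) pp); first by lra.
exact: le_trans (bregman_le_excess opt nondeg sp) (le_trans ex tol_le_c_0).
Qed.

(** A support index off S would have score at least d - gamma_sc / 2 by the test and at most (d -
    gamma_sc) / (1 - rbar) by proximity; these contradict rbar <= gamma_sc / (2 d). *)
Lemma loop_exit_warm p : design A p -> ~~ loop_test A (gamma_sc A ps) c p ->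
  warm A ps p.
Proof.
move=> Dp; rewrite /loop_test negb_or -!leNgt => /andP[hgap hlev].
have [ex near] := near_of_gap Dp hgap; have [[p0 p1] pp] := Dp.
split=> //; split=> //; apply: suppP => i iS; apply/eqP.
apply: contraT => pi; exfalso.
have pi0 : 0 < p 0 i by rewrite lt_neqAle eq_sym pi p0.
have [/andP[r0 r1] hr _] := rbarP opt nondeg zs_neq0.
have [[_ all]|[g gE [g0 gle]]] := gamma_sc_cases nondeg; first by rewrite all in iS.
have d2 := dim_ge2R opt nondeg zs_neq0.
move: hlev hr; rewrite gE -!EFinM -EFinB => /minlev_supp_ge/(_ i pi0) h1.
rewrite lee_fin ler_pdivlMr => [h2|]; last by lra.
have [h3 _] := near i; have h4 := gle i iS; set r := rbar A ps in r0 r1 h2 h3.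
rewrite ler_pdivlMr in h3; last by lra.
have h5 : (d%:R - g * 2^-1) * (1 - r) <= lev A p i * (1 - r) by rewrite ler_wpM2r //; lra.
have h6 : 0 < g * r by rewrite mulr_gt0.
by clear hgap; lra.
Qed.

(** On the face the scores are at least d / (1 + rbar), which is above d - gamma_sc / 2. So the loop
    stops no later than the maximum of K_id and K_gap. *)
Lemma loop_test_false p : design A p -> supp p \subset S ->
  (maxgap A p <= c%:E)%E -> ~~ loop_test A (gamma_sc A ps) c p.
Proof.
move=> Dp sp hgap; rewrite /loop_test negb_or -!leNgt hgap /=.
have [ex near] := near_of_gap Dp hgap; have [[p0 p1] pp] := Dp.
have [/andP[r0 r1] hr _] := rbarP opt nondeg zs_neq0.
have d2 := dim_ge2R opt nondeg zs_neq0.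
have [[gE _]|[g gE [g0 gle]]] := gamma_sc_cases nondeg.
  by rewrite gE gt0_mulye ?lte_fin ?invr_gt0 // leNye.
move: hr; rewrite gE -!EFinM -EFinB lee_fin ler_pdivlMr => [h2|]; last by lra.
apply/minlev_supp_ge => i pi.
have iS : i \in S by apply: contraTT pi => iS; rewrite (supp_out sp iS) ltxx.
have [_ h] := near i; apply: le_trans h; rewrite (lev_Sstar iS).
set r := rbar A ps in r0 r1 h2 *; rewrite ler_pdivlMr; last by lra.
have h6 : 0 < g * r by rewrite mulr_gt0.
by clear hgap; lra.
Qed.

End LoopExit.

Theorem theorem5p5 (R : realType) :
  exists C : R, forall (n d : nat) (A : 'M[R]_(n, d)) (ps : 'rV[R]_n) (eps : R),
    \rank A = d -> optimal_design A ps -> nondegenerate_design A ps ->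
    zero_sum (R:=R) (Sstar A ps) <> [set 0] ->
    0 < eps < 1 ->
    forall P : nat -> 'rV[R]_n, afw_sequence A P ->
    let S := Sstar A ps in
    let c := tol A ps in
    (exists K_id, is_K_id S P K_id) /\
    (forall e : R, 0 < e -> exists K_gap, is_K_gap A e P K_gap) /\
    exists k r : nat,
      let x0 := P k in
      let L := L_loc A ps in
      let kl := kappa_loc A ps in
      let out := facial_point A S L kl x0 r in
      let loop_qs := loop_queries P k in
      let facial_qs := facial_queries A S L kl x0 r in
      [/\ loop_exit A (gamma_sc A ps) c P k,
          facial_return A S L kl eps x0 r,
          [/\ simplex out, posdef (infoM A out) &
              (maxlev A out <= ((1 + eps) * d%:R)%:E)%E],
          forall K_id K_gap : nat,
            is_K_id S P K_id -> is_K_gap A (c / d%:R) P K_gap ->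
            (size (loop_qs ++ facial_qs))%:R <=
              (maxn K_id K_gap)%:R +
              C * (Num.sqrt (kappa A ps) * ln (Theta_A A ps / eps)) &
          [/\ forall w, w \in loop_qs -> posdef (infoM A w),
              forall w, w \in facial_qs ->
                supp w \subset S /\ posdef (infoM A w) &
              relint (face S) out]].
Proof.
(* 60 from the facial phase, plus 2 to absorb the query of the last loop test, since sqrt kappa
   times the logarithm is at least 1/2. *)
exists 62 => n d A ps eps _ opt nondeg zs eps01 P seqP S c.
have hid := afw_K_id opt nondeg zs seqP.
have hgap := @afw_K_gap _ _ _ _ _ opt nondeg zs P seqP.
have Dk := afw_design opt nondeg zs seqP.
split; [exact: hid | split; first by move=> e; exact: hgap].
have d2 := dim_ge2R opt nondeg zs.
have c0 : 0 < c := tol_gt0 opt nondeg zs.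
have stop K_id K_gap k : is_K_id S P K_id -> is_K_gap A (c / d%:R) P K_gap ->
    (maxn K_id K_gap <= k)%N -> ~~ loop_test A (gamma_sc A ps) c (P k).
  move=> hi hg; rewrite geq_max => /andP[/hi sk /hg gk].
  by apply: loop_test_false => //; rewrite divfK // in gk; rewrite gt_eqF //; lra.
have [Ki hKi] := hid; have [|Kg hKg] := hgap (c / d%:R).
  by rewrite divr_gt0 //; lra.
have exk : exists k, ~~ loop_test A (gamma_sc A ps) c (P k).
  by exists (maxn Ki Kg); exact: stop hKi hKg (leqnn _).
(* The loop exits at the first failing test, so k is minimal and is bounded by every admissible pair
   of K_id and K_gap. *)
case: (ex_minnP exk) => k hk kmin.
have wk := loop_exit_warm opt nondeg zs (Dk k) hk.
have [r [ret wout gout size_le qs]] := facial_phase opt nondeg zs eps01 wk.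
exists k, r; cbv zeta; split.
- by split=> // j; rewrite ltnNge; apply: contraNT; exact: kmin.
- exact: ret.
- case: (wout) => -[sout _] pout _; split=> //.
  by apply/maxlev_le => i; move/maxgap_le: gout => /(_ i); lra.
- move=> K_id K_gap hi hg; rewrite size_cat natrD /loop_queries size_map size_iota.
  have kle : k.+1%:R <= (maxn K_id K_gap)%:R + 1 :> R.
    by rewrite natr1 ler_nat ltnS; apply: kmin; exact: stop hi hg (leqnn _).
  have s1 := sqrt_kappa_ge1 opt nondeg zs; have l2 := ln_ratio_ge_half A ps eps01.
  have h : 1 * 2^-1 <= Num.sqrt (kappa A ps) * ln (Theta_A A ps / eps).
    by apply: ler_pM => //; lra.
  by lra.
- split.
  + by move=> w /mapP[j _ ->]; case: (Dk j).
  + exact: qs.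
  + exact: warm_relint.
Qed.
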